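(* Let $R$ be an $F$-finite regular domain of characteristic $p>0$, let $\mathfrak{a}=\langle g_1,\ldots,g_m\rangle$ be an ideal of $R$, let $z=z_1,\ldots,z_m$ be variables over $R$, and let $G=z_1g_1+\cdots+z_mg_m\in R[z]=R[z_1,\ldots,z_m]$. If $t$ is a real number with $0<t<1$, then $\tau(G^t)=\mathfrak{a}^{[t]}R[z]$ and $\mathfrak{a}^{[t]}=\tau(G^t)\cap R$, where $\tau(G^t)$ is the test ideal of $G$ in $R[z]$ and $\mathfrak{a}^{[t]}$ is the generalized Frobenius power.
   Context: A ring $S$ of characteristic $p$ is $F$-finite if it is a finitely generated module over $S^p$; the definitions below apply to any $F$-finite regular domain $S$ of characteristic $p$ (such as $R$ and $R[z]$). Frobenius powers: let $q$ denote a power $p^e$, $e\ge 0$. For an ideal $\mathfrak{a}$ of $S$, $\mathfrak{a}^{[q]}=\langle f^q: f\in\mathfrak{a}\rangle$. For $k\in\mathbb{N}$ with base $p$ expansion $k=k_0+k_1p+\cdots+k_rp^r$, $\mathfrak{a}^{[k]}=\mathfrak{a}^{k_0}(\mathfrak{a}^{k_1})^{[p]}\cdots(\mathfrak{a}^{k_r})^{[p^r]}$ (with $\mathfrak{a}^0=S$). $\mathfrak{a}^{[1/q]}$ is the smallest ideal $\mathfrak{c}$ of $S$ with $\mathfrak{a}\subseteq\mathfrak{c}^{[q]}$, and $\mathfrak{a}^{[k/q]}=(\mathfrak{a}^{[k]})^{[1/q]}$ (well defined). For real $t\ge 0$ and $\mathfrak{a}$ nonzero, $\mathfrak{a}^{[t]}=\bigcup_k\mathfrak{a}^{[t_k]}$,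 where $(t_k)$ is any sequence of rational numbers with $p$-power denominators converging to $t$ monotonically from above, e.g. $t_k=\lceil p^kt\rceil/p^k$ (the union is of an ascending chain and independent of the sequence); also $\langle 0\rangle^{[t]}=\langle 0\rangle$ for $t>0$ and $\langle 0\rangle^{[0]}=S$. Test ideals: for $t>0$ and an ideal $\mathfrak{a}$ of $S$, $\tau(\mathfrak{a}^t)=\bigcup_{e\ge 0}(\mathfrak{a}^{\lceil tp^e\rceil})^{[1/p^e]}$ (an ascending union), and $\tau(f^t)=\tau(\langle f\rangle^t)$ for $f\in S$. *)

(* Defs.v *)
From HB Require Import structures.
From mathcomp Require Import all_boot all_order all_algebra.
From mathcomp Require Import boolp classical_sets reals.
From mathcomp Require Import mpoly.

Set Implicit Arguments.
Unset Strict Implicit.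
Unset Printing Implicit Defensive.

Import Order.TTheory GRing.Theory Num.Theory.
Local Open Scope classical_set_scope.
Local Open Scope ring_scope.

Section Ideals.
Variable S : comNzRingType.
Implicit Types (I J M P : set S).

Definition is_ideal I : Prop :=
  [/\ I 0, forall x y, I x -> I y -> I (x + y) & forall a x, I x -> I (a * x)].

Definition idealgen (X : set S) : set S := smallest is_ideal X.

Definition is_prime P : Prop :=
  [/\ is_ideal P, ~ P 1 & forall x y, P (x * y) -> P x \/ P y].

Definition is_maximal M : Prop :=
  [/\ is_ideal M, ~ M 1 & forall J, is_ideal J -> ~ J 1 -> M `<=` J -> J = M].

Definition ideal_mul I J : set S :=
  idealgen [set u | exists x y, [/\ I x, J y & u = x * y]].

Definition ideal_pow I (n : nat) : set S := iter n (ideal_mul I) setT.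

Definition noetherian : Prop :=
  forall I, is_ideal I -> exists n (x : 'I_n -> S), I = idealgen (range x).

(* [P 0 `<` ... `<` P n]: a chain of [n.+1] primes, of length [n]. *)
Definition prime_chain (n : nat) (P : 'I_n.+1 -> set S) : Prop :=
  (forall i, is_prime (P i)) /\ (forall i j : 'I_n.+1, (i < j)%N -> P i `<` P j).

Definition has_krull_dim (d : nat) : Prop :=
  (exists P : 'I_d.+1 -> set S, prime_chain P) /\
  (forall n (P : 'I_n.+1 -> set S), prime_chain P -> (n <= d)%N).

Definition regular_local : Prop :=
  noetherian /\
  exists M, [/\ is_maximal M,
    forall N, is_maximal N -> N = M &
    exists d, has_krull_dim d /\
      exists x : 'I_d -> S, M = idealgen (range x)].

End Ideals.

Record primeIdeal (S : comNzRingType) := PrimeIdeal {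
  prime_carrier : set S;
  primeIdealP : is_prime prime_carrier }.

(* The localization of a domain at a prime, as a subring of its fraction
   field. *)
Section Localization.
Variables (R : idomainType) (P : primeIdeal R).

Definition loc_pred : {pred {fraction R}} :=
  fun x => `[< exists a b : R, ~ prime_carrier P b /\ x = tofrac a / tofrac b >].

Lemma loc_subring_closed : subring_closed loc_pred.
Proof.
have [[P0 PD PM] P1 Pprime] := primeIdealP P.
have nz (b : R) : ~ prime_carrier P b -> tofrac b != 0.
  by move=> Pb; rewrite tofrac_eq0; apply/eqP => b0; apply: Pb; rewrite b0.
have Pmul (b d : R) : ~ prime_carrier P b -> ~ prime_carrier P d ->
    ~ prime_carrier P (b * d).
  by move=> Pb Pd /Pprime[].
split.
- by apply/asboolP; exists 1, 1; rewrite tofrac1 divr1.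
- move=> _ _ /asboolP[a [b [Pb ->]]] /asboolP[c [d [Pd ->]]].
  apply/asboolP; exists (a * d - c * b), (b * d); split; first exact: Pmul.
  by rewrite tofracB !tofracM -mulNr addf_div ?nz // mulNr.
- move=> _ _ /asboolP[a [b [Pb ->]]] /asboolP[c [d [Pd ->]]].
  apply/asboolP; exists (a * c), (b * d); split; first exact: Pmul.
  by rewrite !tofracM mulf_div.
Qed.

HB.instance Definition _ :=
  GRing.isSubringClosed.Build {fraction R} loc_pred loc_subring_closed.

Record localization := Localization {
  loc_val : {fraction R};
  loc_valP : loc_val \in loc_pred }.

HB.instance Definition _ := [isSub for loc_val].
HB.instance Definition _ := [Choice of localization by <:].
HB.instance Definition _ := [SubChoice_isSubComNzRing of localization by <:].

End Localization.

Definition regular_domain (R : idomainType) : Prop :=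
  noetherian R /\ forall P : primeIdeal R, regular_local (localization P).

Definition F_finite (p : nat) (S : comNzRingType) : Prop :=
  exists n (b : 'I_n -> S),
    forall x, exists c : 'I_n -> S, x = \sum_(i < n) c i ^+ p * b i.

Section FrobeniusPowers.
Variables (p : nat) (S : comNzRingType).
Implicit Types (a : set S) (k e : nat).

(* [a^[q]], for [q] a power of [p] *)
Definition frob_pow_q (q : nat) a : set S := idealgen [set f ^+ q | f in a].

Definition digit k i : nat := ((k %/ p ^ i) %% p)%N.

(* [a^[k]]; [trunc_log p k] is the index of the leading base [p] digit of [k]. *)
Definition frob_pow a k : set S :=
  \big[@ideal_mul S/setT]_(i < (trunc_log p k).+1)
    frob_pow_q (p ^ i) (ideal_pow a (digit k i)).

(* [a^[1/p^e]], the smallest ideal [c] with [a `<=` c^[p^e]], written as the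
   intersection of all such ideals. *)
Definition frob_root e a : set S :=
  \bigcap_(c in [set c | is_ideal c /\ a `<=` frob_pow_q (p ^ e) c]) c.

(* [a^[k/p^e]] *)
Definition frob_pow_frac a k e : set S := frob_root e (frob_pow a k).

(* [ceil (t p^e)], as a natural number; meant for [0 <= t]. *)
Definition ceil_pexp (K : realType) (t : K) e : nat :=
  `|Num.ceil (t * p%:R ^+ e)|%N.

(* [a^[t]] for [0 <= t], along the sequence [ceil (p^e t) / p^e].  The
   conventions [<0>^[t] = <0>] for [0 < t] and [<0>^[0] = S] need no special
   case: [<0>^[k] = <0>] for [0 < k], and [<0>^[0] = S]. *)
Definition frob_pow_real (K : realType) a (t : K) : set S :=
  \bigcup_e frob_pow_frac a (ceil_pexp t e) e.

(* [tau(a^t)]; here the inner power of [a] is the ordinary one. *)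
Definition test_ideal (K : realType) a (t : K) : set S :=
  \bigcup_e frob_root e (ideal_pow a (ceil_pexp t e)).

End FrobeniusPowers.

Definition generic_comb (R : idomainType) (m : nat) (g : 'I_m -> R) :
  {mpoly R[m]} := \sum_(i < m) 'X_i * (g i)%:MP.

(* Main.v *)
(** By Lucas's theorem the coefficients of [G ^+ k] generate [a^[k]].  For
    [k < q = p ^ e] every monomial of [G ^+ k] has exponents below [q], so it is a
    distinct basis element of [R[z]] over [R[z ^ q]]; if [G ^+ k] lies in [C^[q]],
    then each coefficient lies in the contraction to [R] of an ideal extended from
    [R ^ q [z ^ q]], hence in [(C `&` R)^[q]] because [R] is flat over [R ^ q].
    Thus [(G ^+ k)^[1/q] = a^[k/q] R[z]], and [ceil (t q) < q] for large [q].

    Flatness is Kunz's theorem.  In a regular local ring, Krull's principal ideal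
    theorem shows that any subset of a regular system of parameters [x] generates
    a prime ideal, so the powers of [x] form a regular sequence in any order;
    comparing along it, a minimal generating family over the [p]-th powers is
    free.  Over [R] one concludes with the ideal of denominators. *)
Require Import Defs.
From mathcomp Require Import all_boot all_order all_algebra.
From mathcomp Require Import boolp classical_sets reals.
From mathcomp Require Import mpoly ring lra zify.

Set Implicit Arguments.
Unset Strict Implicit.
Unset Printing Implicit Defensive.

Import Order.TTheory GRing.Theory Num.Theory.
Local Open Scope classical_set_scope.
Local Open Scope ring_scope.

(** * Krull's principal ideal theorem *)

(** Dimension enters through chains of primes: by Krull's theorem, forcing the next prime of a chain
    to contain a given element of the maximal ideal shortens the chain by at most one. With [d]
    parameters against a chain of length [d] there is no slack, and this makes every subset of the
    parameters generate a prime. No quotient or localization is formed for this: an ideal of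
    [S / P0] localized at [Q] is an ideal of [S] that contains [P0] and is saturated at [Q].
    Flatness is kept in equational form: a solution of a system with coefficients [a ^ q] is a
    combination of [q]-th powers of solutions of the system with coefficients [a]. In this form it
    passes to [R] by clearing denominators, and by induction to matrices and to [p ^ e]; it also
    shows that [x ^ q] in [I^[q]] forces [x] in [I]. This last fact settles the finitely many levels
    where [ceil (t q) = q] and exponents of [G ^ q] reach [q]: there the root is contained in [(G)],
    hence in the extension of [a], and [a] is contained in [a^[t]]. *)

Section IdealTheory.
Variable S : comNzRingType.
Implicit Types (I J K M P Q A B X Y : set S).

Lemma ideal0 I : is_ideal I -> I 0. Proof. by case. Qed.

Lemma idealD I x y : is_ideal I -> I x -> I y -> I (x + y).
Proof. by case=> _ + _; apply. Qed.

Lemma ideal_mull I a x : is_ideal I -> I x -> I (a * x).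
Proof. by case=> _ _; apply. Qed.

Lemma ideal_mulr I a x : is_ideal I -> I x -> I (x * a).
Proof. by move=> iI Ix; rewrite mulrC; apply: ideal_mull. Qed.

Lemma idealN I x : is_ideal I -> I x -> I (- x).
Proof. by move=> iI Ix; rewrite -mulN1r; apply: ideal_mull. Qed.

Lemma idealB I x y : is_ideal I -> I x -> I y -> I (x - y).
Proof. by move=> iI Ix Iy; apply: idealD => //; apply: idealN. Qed.

Lemma ideal_sum I (T : Type) (r : seq T) (C : pred T) (F : T -> S) :
  is_ideal I -> (forall i, C i -> I (F i)) -> I (\sum_(i <- r | C i) F i).
Proof.
by move=> iI IF; apply: big_ind => //; [exact: ideal0 | move=> x y; exact: idealD].
Qed.

Lemma idealgen_ideal X : is_ideal (@idealgen S X).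
Proof.
split=> [I [iI _]|x y gx gy I [iI XI]|a x gx I [iI XI]]; first exact: ideal0.
- by apply: idealD => //; [exact: gx | exact: gy].
- by apply: ideal_mull => //; exact: gx.
Qed.

Lemma sub_idealgen X : X `<=` @idealgen S X.
Proof. by move=> x Xx I [_]; apply. Qed.

Lemma idealgen_min X I : is_ideal I -> X `<=` I -> @idealgen S X `<=` I.
Proof. by move=> iI XI x; apply. Qed.

Lemma idealgenS X Y : X `<=` Y -> @idealgen S X `<=` @idealgen S Y.
Proof.
move=> XY; apply: idealgen_min; first exact: idealgen_ideal.
by move=> x /XY; exact: sub_idealgen.
Qed.

Lemma idealgen_sum X z : @idealgen S X z ->
  exists n (c f : 'I_n -> S), (forall i, X (f i)) /\ z = \sum_(i < n) c i * f i.
Proof.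
pose I : set S := [set z | exists n (c f : 'I_n -> S),
  (forall i, X (f i)) /\ z = \sum_(i < n) c i * f i].
suff: idealgen X `<=` I by apply.
apply: idealgen_min => [|x Xx]; last first.
  by exists 1%N, (fun=> 1), (fun=> x); rewrite big_ord1 mul1r.
split=> [|_ _ [n [c [f [Xf ->]]]] [k [d [h [Xh ->]]]]|a _ [n [c [f [Xf ->]]]]].
- by exists 0%N, (fun=> 0), (fun=> 0); split=> [[]//|]; rewrite big_ord0.
- exists (n + k)%N.
  exists (fun i => match split i with inl j => c j | inr j => d j end).
  exists (fun i => match split i with inl j => f j | inr j => h j end).
  split=> [i|]; first by case: (split i).
  rewrite big_split_ord /=; congr (_ + _); apply: eq_bigr => i _.
    by rewrite (unsplitK (inl i)).
  by rewrite (unsplitK (inr i)).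
- exists n, (fun i => a * c i), f; split=> //.
  by rewrite mulr_sumr; apply: eq_bigr => i _; rewrite mulrA.
Qed.

Lemma idealgen1P x z : idealgen [set x] z <-> exists r, z = r * x :> S.
Proof.
split=> [|[r ->]]; last first.
  by apply: (ideal_mull _ (idealgen_ideal _)); exact: sub_idealgen.
suff: idealgen [set x] `<=` [set z | exists r, z = r * x] by apply.
apply: idealgen_min => [|_ ->]; last by exists 1; rewrite mul1r.
split=> [|_ _ [r ->] [s ->]|a _ [r ->]]; first by exists 0; rewrite mul0r.
  by exists (r + s); rewrite mulrDl.
by exists (a * r); rewrite mulrA.
Qed.

Definition ideal_adjoin I (x : S) : set S := [set z | exists w r, I w /\ z = w + r * x].

Lemma ideal_adjoin_ideal I x : is_ideal I -> is_ideal (ideal_adjoin I x).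
Proof.
move=> iI; split.
- by exists 0, 0; rewrite mul0r addr0; split=> //; exact: ideal0.
- move=> _ _ [w [r [Iw ->]]] [w' [r' [Iw' ->]]].
  by exists (w + w'), (r + r'); split; [exact: idealD | ring].
- move=> a _ [w [r [Iw ->]]].
  by exists (a * w), (a * r); split; [exact: ideal_mull | ring].
Qed.

Lemma sub_ideal_adjoin I x : I `<=` ideal_adjoin I x.
Proof. by move=> z Iz; exists z, 0; rewrite mul0r addr0. Qed.

Lemma mem_ideal_adjoin I x : is_ideal I -> ideal_adjoin I x x.
Proof. by move=> iI; exists 0, 1; rewrite mul1r add0r; split=> //; exact: ideal0. Qed.

Lemma prime_ideal P : is_prime P -> is_ideal P. Proof. by case. Qed.

Lemma primeNM P x y : is_prime P -> ~ P x -> ~ P y -> ~ P (x * y).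
Proof. by move=> [_ _ prm] Px Py /prm[]. Qed.

Lemma primeN1 P : is_prime P -> ~ P 1. Proof. by case. Qed.

Lemma prime_exp P x n : is_prime P -> P (x ^+ n) -> P x.
Proof.
move=> pP; have [_ _ prm] := pP; elim: n => [|n IHn].
  by rewrite expr0 => /(primeN1 pP).
by rewrite exprS => /prm[].
Qed.

(** Without a maximal member, choice yields a strictly ascending chain; its union is finitely
    generated, hence equal to one of the terms. *)
Lemma noetherian_max (F : set (set S)) : noetherian S ->
  F `<=` @is_ideal S -> F !=set0 ->
  exists I, F I /\ forall J, F J -> I `<=` J -> J `<=` I.
Proof.
move=> noeS Fideal [I0 FI0]; apply: contrapT => nomax.
have next (I : {I | F I}) : exists J : {J | F J}, sval I `<=` sval J /\ ~ sval J `<=` sval I.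
  case: I => I FI; apply: contrapT => nonext; apply: nomax; exists I; split=> // J FJ IJ.
  by apply: contrapT => JI; apply: nonext; exists (exist _ J FJ).
have [f fP] := choice next.
pose I_ n : set S := sval (iter n f (exist _ I0 FI0)).
have iI n : is_ideal (I_ n) by apply: Fideal; rewrite /I_; case: (iter _ _ _).
have IS n : I_ n `<=` I_ n.+1 by case: (fP (iter n f (exist _ I0 FI0))).
have Ile m n : (m <= n)%N -> I_ m `<=` I_ n.
  elim: n => [|n IHn]; first by rewrite leqn0 => /eqP->.
  by rewrite leq_eqVlt => /predU1P[-> //|/IHn mn x /mn]; exact: IS.
pose U : set S := [set x | exists n, I_ n x].
have iU : is_ideal U.
  split=> [|x y [m Ix] [n Iy]|a x [n Ix]]; first by exists 0%N; exact: ideal0.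
    exists (maxn m n); apply: idealD => //; first exact: (Ile m) (leq_maxl _ _) _ Ix.
    exact: (Ile n) (leq_maxr _ _) _ Iy.
  by exists n; apply: ideal_mull.
have [n [x Ux]] := noeS U iU.
have Ux' i : exists k, I_ k (x i).
  by have : U (x i) by [rewrite Ux; apply: sub_idealgen; exists i].
have [k kP] := choice Ux'.
have UI : U `<=` I_ (\max_i k i).
  rewrite Ux; apply: idealgen_min => // _ [i _ <-].
  by apply: Ile (kP i); exact: leq_bigmax.
case: (fP (iter (\max_i k i) f (exist _ I0 FI0))) => _; apply => z Iz.
by apply: UI; exists (\max_i k i).+1.
Qed.

Lemma proper_sub_maximal I : noetherian S -> is_ideal I -> ~ I 1 ->
  exists M, is_maximal M /\ I `<=` M.
Proof.
move=> noeS iI I1.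
have [||M [[iM M1 IM] maxM]] := @noetherian_max [set J | [/\ is_ideal J, ~ J 1 & I `<=` J]] noeS.
- by move=> J [].
- by exists I; split.
exists M; split=> //; split=> // J iJ J1 MJ; apply/seteqP; split=> //.
by apply: maxM => //; split=> // x /IM /MJ.
Qed.

Lemma maximal_prime M : is_maximal M -> is_prime M.
Proof.
move=> [iM M1 maxM]; split=> // x y Mxy; apply: contrapT => /not_orP[Mx My].
have xM z : ~ M z -> exists r w, M w /\ 1 = w + r * z.
  move=> Mz; suff [w [r [Mw ->]]] : ideal_adjoin M z 1 by exists r, w.
  apply: contrapT => n1; apply: Mz.
  rewrite -(maxM _ (ideal_adjoin_ideal z iM) n1); first exact: mem_ideal_adjoin.
  exact: sub_ideal_adjoin.
have [r [w [Mw e1]]] := xM _ Mx; have [s [v [Mv e2]]] := xM _ My.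
apply: M1.
have -> : 1 = w * (v + s * y) + (r * x) * v + (r * s) * (x * y).
  by rewrite -[LHS]mulr1 [X in X * _]e1 [X in _ * X]e2; ring.
by do 2 ?apply: idealD => //; [exact: ideal_mulr | exact: ideal_mull | exact: ideal_mull].
Qed.

(* The contraction to [S] of the extension of [J] to the localization at [Q]. *)
Definition sat Q J : set S := [set z | exists s, ~ Q s /\ J (s * z)].

Definition saturated Q J : Prop := sat Q J `<=` J.

Lemma sat_ideal Q J : is_prime Q -> is_ideal J -> is_ideal (sat Q J).
Proof.
move=> pQ iJ; split.
- by exists 1; rewrite mulr0; split; [exact: primeN1 | exact: ideal0].
- move=> x y [s [Qs Jx]] [t [Qt Jy]]; exists (s * t); split; first exact: primeNM.
  rewrite mulrDr; apply: idealD => //.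
    by rewrite mulrAC; apply: ideal_mulr.
  by rewrite -mulrA; apply: ideal_mull.
- by move=> a x [s [Qs Jx]]; exists s; split=> //; rewrite mulrCA; apply: ideal_mull.
Qed.

Lemma sub_sat Q J : is_prime Q -> J `<=` sat Q J.
Proof. by move=> pQ z Jz; exists 1; rewrite mul1r; split=> //; exact: primeN1. Qed.

Lemma satS Q J K : J `<=` K -> sat Q J `<=` sat Q K.
Proof. by move=> JK z [s [Qs /JK Kz]]; exists s. Qed.

Lemma sat_saturated Q Q' J : is_prime Q -> Q `<=` Q' -> saturated Q' (sat Q J).
Proof.
move=> pQ QQ' z [s [Q's [t [Qt Jz]]]]; exists (t * s); split; last by rewrite -mulrA.
by apply: primeNM => // /QQ'.
Qed.

(* Elimination of one generator at a time, as in Gaussian elimination; the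
   pivots [s - c n] stay outside [Q]. *)
Lemma nakayama_family Q J n (y : nat -> S) : is_prime Q -> is_ideal J ->
  (forall i, (i < n)%N -> exists s (c : nat -> S), [/\ ~ Q s, forall j, Q (c j) &
     J (s * y i - \sum_(j < n) c j * y j)]) ->
  exists s, ~ Q s /\ forall i, (i < n)%N -> J (s * y i).
Proof.
move=> pQ iJ; have iQ := prime_ideal pQ; elim: n => [|n IHn] H.
  by exists 1; split=> //; exact: primeN1.
have [s [d [Qs Qd Jn]]] := H n (ltnSn n).
pose t := s - d n; have Qt : ~ Q t.
  by move=> Qt; apply: Qs; rewrite -(subrK (d n) s); apply: idealD.
have {}Jn : J (t * y n - \sum_(j < n) d j * y j).
  by move: Jn; rewrite big_ord_recr /= /t mulrBl; congr J; ring.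
have [i lt_in|s' [Qs' Js']] := IHn.
  have [s1 [c [Qs1 Qc Ji]]] := H i (leqW lt_in).
  exists (t * s1), (fun j => t * c j + c n * d j); split.
  - exact: primeNM.
  - by move=> j; apply: idealD => //; apply: ideal_mull.
  have := idealD iJ (ideal_mull t iJ Ji) (ideal_mull (c n) iJ Jn).
  congr J; rewrite big_ord_recr /=.
  under [X in _ = _ - X]eq_bigr do rewrite mulrDl -!mulrA.
  by rewrite big_split /= -!mulr_sumr; ring.
exists (s' * t); split=> [|i]; first exact: primeNM.
rewrite ltnS leq_eqVlt => /predU1P[->|lt_in].
  have -> : s' * t * y n = s' * (t * y n - \sum_(j < n) d j * y j)
     + \sum_(j < n) d j * (s' * y j).
    under [X in _ = _ + X]eq_bigr do rewrite mulrCA.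
    by rewrite -mulr_sumr; ring.
  apply: idealD => //; first exact: ideal_mull.
  by apply: ideal_sum => // j _; apply: ideal_mull => //; exact: Js'.
by rewrite mulrAC; apply: ideal_mulr => //; exact: Js'.
Qed.

(** Locally at [Q] the hypothesis reads [I <= J + x I]. Expressed in generators of [I], it is a
    linear system with coefficients in [x S], hence in [Q], as [nakayama_family] requires. *)
Lemma nakayama Q I J x : noetherian S -> is_prime Q -> is_ideal I -> is_ideal J ->
  Q x -> (forall z, I z -> exists s w, [/\ ~ Q s, I w & J (s * z - x * w)]) ->
  I `<=` sat Q J.
Proof.
move=> noeS pQ iI iJ Qx H.
have [n [f If]] := noeS I iI.
have If' z : I z -> exists c : 'I_n -> S, z = \sum_i c i * f i.
  rewrite If => /idealgen_sum[k [c [h [hf ->]]]].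
  have {}hf i : exists j, f j = h i by case: (hf i) => j _ <-; exists j.
  have [g gP] := choice hf.
  exists (fun j => \sum_(i < k | g i == j) c i).
  rewrite (partition_big g predT) //=; apply: eq_bigr => j _.
  by rewrite mulr_suml; apply: eq_bigr => i /eqP<-; rewrite gP.
(* A nonempty index type lets [inord] reindex the generators by [nat]. *)
case: n => [|n] in f If If' *.
  move=> z /If'[c ->]; rewrite big_ord0.
  by apply: ideal0; exact: sat_ideal.
pose y j := f (inord j).
have [i _|s [Qs Js]] := @nakayama_family Q J n.+1 y pQ iJ.
  have [|s [w [Qs Iw Jz]]] := H (y i); first by rewrite If; apply: sub_idealgen; exists (inord i).
  have [c wE] := If' w Iw.
  exists s, (fun j => x * c (inord j)); split=> // [j|]; first by apply: ideal_mulr => //; exact: prime_ideal.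
  suff -> : \sum_(j < n.+1) x * c (inord j) * y j = x * w by [].
  rewrite wE mulr_sumr; apply: eq_bigr => j _.
  by rewrite /y inord_val mulrA.
move=> z /If'[c ->]; exists s; split=> //; rewrite mulr_sumr.
apply: ideal_sum => // i _; rewrite mulrCA; apply: ideal_mull => //.
by rewrite -[i]inord_val; exact: Js.
Qed.

(** Existence of an associated prime of [S / A]: a maximal annihilator of a nonzero class is
    prime. *)
Lemma exists_prime_colon A : noetherian S -> is_ideal A -> ~ A 1 ->
  exists y, ~ A y /\ is_prime [set r | A (r * y)].
Proof.
move=> noeS iA A1.
have icol y : is_ideal [set r | A (r * y)].
  split=> /= [|r s Ar As|a r Ar]; first by rewrite mul0r; exact: ideal0.
    by rewrite mulrDl; apply: idealD.
  by rewrite -mulrA; apply: ideal_mull.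
have [||_ [[y [Ay ->]] maxy]] :=
    @noetherian_max [set B | exists y, ~ A y /\ B = [set r | A (r * y)]] noeS.
- by move=> _ [y [_ ->]].
- by exists [set r | A (r * 1)], 1.
exists y; split=> //; split=> //=; first by rewrite mul1r.
move=> a b /= Aab; have [Aby|Aby] := pselect (A (b * y)); [by right | left].
apply: (maxy [set r | A (r * (b * y))]) => /=.
- by exists (b * y).
- by move=> r /= Ary; rewrite mulrCA; apply: ideal_mull.
- by rewrite mulrA.
Qed.

Definition stationary (I_ : nat -> set S) : Prop :=
  exists N, forall n, (N <= n)%N -> I_ N `<=` I_ n.

(* The localization of [S / (P0 + x)] at [Q] is Artinian. *)
Lemma saturated_stationary P0 Q x A (I_ : nat -> set S) : noetherian S ->
  is_prime Q ->
  (forall P, is_prime P -> P0 `<=` P -> P x -> P `<=` Q -> Q `<=` P) ->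
  is_ideal A -> saturated Q A -> P0 `<=` A -> A x ->
  (forall n, [/\ is_ideal (I_ n), saturated Q (I_ n) & A `<=` I_ n]) ->
  (forall n, I_ n.+1 `<=` I_ n) -> stationary I_.
Proof.
move=> noeS pQ minQ iA satA PA Ax IP Idec; apply: contrapT => nstat.
(* Noetherian induction: [B] will be maximal among the saturated ideals lying below some
   nonstationary chain. *)
pose F : set (set S) := [set B | [/\ is_ideal B, saturated Q B, A `<=` B &
  exists I_ : nat -> set S,
   [/\ forall n, [/\ is_ideal (I_ n), saturated Q (I_ n) & B `<=` I_ n],
       forall n, I_ n.+1 `<=` I_ n & ~ stationary I_]]].
have [||B [[iB satB AB [{nstat IP Idec}I_ [IP Idec nstat]]] maxB]] := @noetherian_max F noeS.
- by move=> B [].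
- by exists A; split=> //; exists I_.
have Ile m n : (m <= n)%N -> I_ n `<=` I_ m.
  elim: n => [|n IHn]; first by rewrite leqn0 => /eqP->.
  by rewrite leq_eqVlt => /predU1P[-> //|/IHn mn z /Idec /mn].
have B1 : ~ B 1.
  move=> B1; apply: nstat; exists 0%N => n _ z _; case: (IP n) => iI _ BI.
  by rewrite -[z]mulr1; apply: ideal_mull => //; exact: BI.
have [y [By pBy]] := exists_prime_colon noeS iB B1.
(* The prime [B : y] lies in [Q] because [B] is saturated, so minimality of [Q] makes them equal:
   modulo [B], the element [y] generates a simple module at [Q]. *)
have QBy : Q `<=` [set r | B (r * y)].
  apply: minQ => //=.
  - by move=> z /PA /AB Bz; apply: ideal_mulr.
  - by apply: ideal_mulr => //; exact: AB.
  - by move=> s /= Bsy; apply: contrapT => Qs; apply: By; apply: satB; exists s.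
pose I' n := sat Q (ideal_adjoin (I_ n) y).
pose B' := sat Q (ideal_adjoin B y).
have BB' : B `<=` B'.
  by move=> z Bz; apply: sub_sat => //; exact: sub_ideal_adjoin.
have adjS (C D : set S) : C `<=` D -> ideal_adjoin C y `<=` ideal_adjoin D y.
  by move=> CD _ [w [r [Cw ->]]]; exists w, r; split=> //; exact: CD.
have [N NP] : stationary I'.
  apply: contrapT => nstat'; apply: By.
  have /maxB/(_ BB') : F B'.
    split.
    - by apply: sat_ideal => //; exact: ideal_adjoin_ideal.
    - exact: sat_saturated.
    - by move=> z /AB /BB'.
    - exists I'; split=> // n; last by apply: satS; apply: adjS.
      case: (IP n) => iI satI BI; split.
      + by apply: sat_ideal => //; exact: ideal_adjoin_ideal.
      + exact: sat_saturated.
      + by apply: satS; apply: adjS.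
  by apply; apply: sub_sat => //; exact: mem_ideal_adjoin.
(* Adjoining [y] made the chain stationary. If [y] is in every [I_ n], adjoining it changes nothing;
   if [y] is missing from [I_ n0], the coefficient [r] of [y] must lie in [Q], so that [r * y] is in
   [B]. *)
apply: nstat; have [[n0 In0y]|Iy] := pselect (exists n, ~ I_ n y); last first.
  exists N => n Nn z Iz.
  have [iI satI _] := IP n; have iIy : I_ n y.
    by apply: contrapT => Iny; apply: Iy; exists n.
  have /(NP n Nn)[s [Qs [w [r [Iw e]]]]] : I' N z.
    by apply: sub_sat => //; exact: sub_ideal_adjoin.
  by apply: satI; exists s; split=> //; rewrite e; apply: idealD => //; apply: ideal_mull.
exists (maxn N n0) => n; rewrite geq_max => /andP[Nn n0n] z Iz.
have [iI satI BI] := IP n; have [iI0 satI0 _] := IP (maxn N n0).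
have /(NP n Nn)[s [Qs [w [r [Iw e]]]]] : I' N z.
  by apply: sub_sat => //; apply: sub_ideal_adjoin; apply: Ile Iz; exact: leq_maxl.
apply: satI; exists s; split=> //; rewrite e; apply: idealD => //; apply: BI.
apply: QBy; apply: contrapT => Qr; apply: In0y.
apply: (Ile n0 (maxn N n0)); first exact: leq_maxr.
apply: satI0; exists r; split=> //.
have -> : r * y = s * z - w by rewrite e; ring.
apply: idealB => //; first exact: ideal_mull.
by apply: Ile Iw; rewrite geq_max Nn.
Qed.

(* Krull's principal ideal theorem in the domain [S / P0] localized at [P2].
   The symbolic powers of [P1] in the usual proof are replaced by the saturations
   at [P1] of [P0 + (y ^ n)], for some [y] in [P1] and not in [P0]. *)
Lemma prime_between P0 P1 P2 x : noetherian S -> is_prime P0 -> is_prime P1 ->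
  is_prime P2 -> P0 `<` P1 -> P1 `<` P2 -> P2 x ->
  exists Q, [/\ is_prime Q, P0 `<` Q, Q `<` P2 & Q x].
Proof.
move=> noeS p0 p1 p2 P01 P12 P2x.
have [P1x|P1x] := pselect (P1 x); first by exists P1.
apply: contrapT => noQ.
have P0x : ~ P0 x by move=> /(properW P01).
have minP2 P : is_prime P -> P0 `<=` P -> P x -> P `<=` P2 -> P2 `<=` P.
  move=> pP P0P Px PP2; apply: contrapT => P2P; apply: noQ; exists P; split=> //.
  by split=> // /(_ x Px).
have [i0 i1 i2] := And3 (prime_ideal p0) (prime_ideal p1) (prime_ideal p2).
have [y P1y P0y] : exists2 y, P1 y & ~ P0 y.
  by have [_ /existsNP[y /not_implyP[]]] := P01; exists y.
pose I_ n := sat P1 (ideal_adjoin P0 (y ^+ n)).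
have iI n : is_ideal (I_ n) by apply: sat_ideal => //; exact: ideal_adjoin_ideal.
have Idec n : I_ n.+1 `<=` I_ n.
  apply: satS => _ [w [r [P0w ->]]]; exists w, (r * y); split=> //.
  by rewrite exprS mulrA.
have adjS (C D : set S) : C `<=` D -> ideal_adjoin C x `<=` ideal_adjoin D x.
  by move=> CD _ [w [r [Cw ->]]]; exists w, r; split=> //; exact: CD.
have [||||n|n|N /(_ N.+1 (leqnSn N)) AN] := @saturated_stationary P0 P2 x
  (sat P2 (ideal_adjoin P0 x)) (fun n => sat P2 (ideal_adjoin (I_ n) x)) noeS p2 minP2.
- by apply: sat_ideal => //; exact: ideal_adjoin_ideal.
- exact: sat_saturated.
- by move=> z P0z; apply: sub_sat => //; exact: sub_ideal_adjoin.
- by apply: sub_sat => //; exact: mem_ideal_adjoin.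
- split; first by apply: sat_ideal => //; exact: ideal_adjoin_ideal.
    exact: sat_saturated.
  apply: satS; apply: adjS => z P0z.
  by apply: sub_sat => //; exact: sub_ideal_adjoin.
- by apply: satS; exact: adjS.
have INsub : I_ N `<=` sat P2 (I_ N.+1).
  apply: (@nakayama P2 (I_ N) (I_ N.+1) x) => // z Iz.
  have [|s [P2s [w [r [Iw e]]]]] := AN z.
    by apply: sub_sat => //; exact: sub_ideal_adjoin.
  exists s, r; split=> //; last by rewrite e mulrC addrK.
  (* Since [x] is outside [P1], it can be cancelled in the [P1]-saturated ideal [I_ N]; thus
     [I_ N <= I_ N.+1 + x I_ N] at [P2]. *)
  apply: (@sat_saturated P1 P1 _ p1) => //; exists x; split=> //.
  have -> : x * r = s * z - w by rewrite e; ring.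
  by apply: (idealB (iI N)); [exact: (ideal_mull _ (iI N)) | exact: Idec].
have [s [P1s [w [r [P0w e]]]]] : I_ N.+1 (y ^+ N).
  apply: (@sat_saturated P1 P2 _ p1); first exact: properW.
  by apply: INsub; apply: sub_sat => //; exact: mem_ideal_adjoin.
(* Stationarity gives [(s - r * y) * y ^+ N] in [P0]. The first factor is not in [P0]: with [y] in
   [P1], that would put [s] in [P1]. *)
apply: P0y; apply: (@prime_exp P0 y N) => //.
have [_ _ prm] := p0.
have /prm[P0sr|//] : P0 ((s - r * y) * y ^+ N).
  by have -> : (s - r * y) * y ^+ N = w by rewrite mulrBl e exprS; ring.
case: P1s; rewrite -(subrK (r * y) s); apply: (idealD i1); last exact: ideal_mull.
exact: (properW P01).
Qed.

End IdealTheory.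

(** * Regular local rings and flatness of the Frobenius *)

Lemma sum_expp (p : nat) (S : comNzRingType) (I : Type) (r : seq I) (P : pred I) (F : I -> S) :
  p \in [pchar S] -> (\sum_(i <- r | P i) F i) ^+ p = \sum_(i <- r | P i) F i ^+ p.
Proof.
by move=> charSp; rewrite -(pFrobenius_autE charSp) rmorph_sum.
Qed.

Section RegularLocal.
Variables (S : comNzRingType) (M : set S).
Hypotheses (noeS : noetherian S) (maxM : is_maximal M).
Hypothesis (locM : forall N, is_maximal N -> N = M).

Let pM : is_prime M := maximal_prime maxM.
Let iM : is_ideal M := prime_ideal pM.

Lemma local_unit s : ~ M s -> exists v, v * s = 1.
Proof.
move=> Ms; apply: contrapT => nunit; apply: Ms.
have [|N [mN sN]] := proper_sub_maximal noeS (idealgen_ideal [set s]).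
  by move/idealgen1P => [v e]; apply: nunit; exists v.
by rewrite -(locM mN); apply: sN; exact: sub_idealgen.
Qed.

Lemma local_saturated J : is_ideal J -> saturated M J.
Proof.
move=> iJ z [s [/local_unit[v vs] Jsz]].
by rewrite -[z]mul1r -vs -mulrA; exact: ideal_mull.
Qed.

Lemma sub_local_max P : is_prime P -> P `<=` M.
Proof.
move=> [iP P1 _]; have [N [mN PN]] := proper_sub_maximal noeS iP P1.
by rewrite -(locM mN).
Qed.

(** This encodes [dim S / P >= n]; the chain is rooted at its smallest prime so that the part above
    [P] can be replaced by induction. *)
Fixpoint chain_from (n : nat) (P : set S) : Prop :=
  is_prime P /\ if n is n'.+1 then exists Q, P `<` Q /\ chain_from n' Q else True.

Lemma chain_from_prime n P : chain_from n P -> is_prime P.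
Proof. by case: n => [|n] []. Qed.

Lemma prime_chain_from n (P : 'I_n.+1 -> set S) :
  prime_chain P -> chain_from n (P ord0).
Proof.
elim: n P => [|n IHn] P [pP ltP]; split=> //.
exists (P (lift ord0 ord0)); split; first exact: ltP.
by apply: (IHn (fun i => P (lift ord0 i))); split=> // i j ij; exact: ltP.
Qed.

(** Killing [y] costs at most one dimension: from the top of the chain downwards, [prime_between]
    replaces each prime by one that contains [y]. *)
Lemma chain_from_shift n P y : M y -> chain_from n.+1 P ->
  exists Q, [/\ P `<` Q, Q y & chain_from n Q].
Proof.
move=> My; elim: n P => [|n IHn] P [pP [Q [PQ cQ]]].
  have QM := sub_local_max (proj1 cQ).
  exists M; split=> //; split=> [z /(properW PQ)/QM //|MP].
  by case: PQ => _; apply=> z /QM /MP.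
have [Q' [QQ' Q'y cQ']] := IHn Q cQ.
have [Q'' [pQ'' PQ'' Q''Q' Q''y]] :=
  prime_between noeS pP (proj1 cQ) (chain_from_prime cQ') PQ QQ' Q'y.
by exists Q''; split=> //; split=> //; exists Q'.
Qed.

Variables (d : nat) (x : 'I_d -> S).
Implicit Types (T U : {set 'I_d}) (f : 'I_d -> S) (a : 'I_d -> nat).

Definition span_on T f : set S := [set y | exists c, y = \sum_(k in T) c k * f k].

Lemma span_on_ideal T f : is_ideal (span_on T f).
Proof.
split=> [|_ _ [c ->] [c' ->]|b _ [c ->]].
- by exists (fun=> 0); rewrite big1 // => k _; rewrite mul0r.
- exists (fun k => c k + c' k).
  by rewrite -big_split; apply: eq_bigr => k _; rewrite mulrDl.
- exists (fun k => b * c k); rewrite mulr_sumr.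
  by apply: eq_bigr => k _; rewrite mulrA.
Qed.

Lemma mem_span_on T f k : k \in T -> span_on T f (f k).
Proof.
move=> Tk; exists (fun l => (l == k)%:R); rewrite (bigD1 k) //= eqxx mul1r.
by rewrite big1 ?addr0 // => l /andP[_ /negPf->]; rewrite mul0r.
Qed.

Lemma span_on_min T f I : is_ideal I -> (forall k, k \in T -> I (f k)) ->
  span_on T f `<=` I.
Proof.
by move=> iI If _ [c ->]; apply: ideal_sum => // k /If; exact: ideal_mull.
Qed.

Lemma span_on0 f z : span_on (finset.set0) f z -> z = 0.
Proof. by move=> [c ->]; rewrite big_set0. Qed.

Lemma span_onU1 T f j : j \notin T ->
  span_on (j |: T)%SET f = ideal_adjoin (span_on T f) (f j).
Proof.
move=> Tj; apply/seteqP; split=> [_ [c ->]|].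
  by rewrite big_setU1 //= addrC; exists (\sum_(k in T) c k * f k), (c j); split=> //; exists c.
move=> _ [w [r [Tw ->]]]; apply: (idealD (span_on_ideal _ _)).
  move: w Tw; apply: span_on_min; first exact: span_on_ideal.
  by move=> k Tk; apply: mem_span_on; rewrite inE Tk orbT.
apply: (ideal_mull _ (span_on_ideal _ _)).
by apply: mem_span_on; rewrite !inE eqxx.
Qed.

Lemma eq_span_on T f f' : {in T, f =1 f'} -> span_on T f = span_on T f'.
Proof.
by move=> ff'; apply/seteqP; split=> _ [c ->]; exists c; apply: eq_bigr => k /ff' ->.
Qed.

Hypothesis (genM : M = idealgen (range x)).

Let Mx k : M (x k). Proof. by rewrite genM; apply: sub_idealgen; exists k. Qed.

Lemma max_span_on : M `<=` span_on (finset.setT) x.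
Proof.
rewrite {1}genM; apply: idealgen_min; first exact: span_on_ideal.
by move=> _ [k _ <-]; apply: mem_span_on; rewrite inE.
Qed.

(* For [T] empty this says that a regular local ring is a domain. *)
Lemma chain_from_span_on n T P : d = (n + #|T|)%N -> chain_from n P ->
  span_on T x `<=` P -> P = span_on T x.
Proof.
elim: n T P => [|n IHn] T P dE cP TP; apply/seteqP; split=> //.
  have -> : T = finset.setT.
    apply/eqP; rewrite eqEcard finset.subsetT cardsT card_ord /=.
    by rewrite [leqLHS]dE.
  by move=> z /(sub_local_max (chain_from_prime cP)) /max_span_on.
have [j Tj] : exists j, j \notin T.
  apply/existsP; rewrite -negb_forall; apply/negP => /forallP allT.
  have : T = finset.setT by apply/setP => j; rewrite allT inE.
  by move=> TT; move: dE; rewrite TT cardsT card_ord; lia.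
have pP := chain_from_prime cP; have iP := prime_ideal pP.
have [Q [PQ Qj cQ]] := chain_from_shift (Mx j) cP.
have iQ := prime_ideal (chain_from_prime cQ).
have QE : Q = span_on (j |: T)%SET x.
  apply: IHn => //; first by rewrite cardsU1 Tj; lia.
  apply: span_on_min => // k; rewrite !inE => /predU1P[-> //|Tk].
  by apply: (properW PQ); apply: TP; exact: mem_span_on.
rewrite span_onU1 // in QE.
have Pj : ~ P (x j).
  move=> Pj; have [_] := PQ; apply; rewrite QE => _ [w [r [Tw ->]]].
  by apply: idealD => //; [exact: TP | exact: ideal_mull].
have iT := span_on_ideal T x.
(* An element of [P] is [w + r * x j] with [w] in the span of [T]; as [x j] is outside [P], [r] is
   in [P]. Hence [P] is the span plus [x j] times [P], and Nakayama applies. *)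
suff : P `<=` sat M (span_on T x).
  by move=> + z Pz => /(_ z Pz) /(local_saturated iT).
apply: (nakayama noeS pM iP iT (Mx j)) => z Pz.
have : Q z by exact: (properW PQ).
rewrite QE => -[w [r [Tw zE]]]; exists 1, r; split=> //.
- exact: primeN1.
- have Prx : P (r * x j).
    have -> : r * x j = z - w by rewrite zE; ring.
    by apply: idealB => //; exact: TP.
  by have [_ _ prm] := pP; have [] := prm _ _ Prx.
- by rewrite mul1r zE (mulrC r) addrK.
Qed.

Variable (P0 : set S).
Hypothesis (chainP0 : chain_from d P0).

(** The case of empty [T] identifies [P0] with the zero ideal; each further parameter then uses up
    one step of the chain, and [chain_from_span_on] recognizes the prime so obtained. *)
Lemma span_on_chain T : chain_from (d - #|T|) (span_on T x).
Proof.
have [n] := ubnP #|T|; elim: n T => // n IHn T; rewrite ltnS => Tn.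
have [->|[j Tj]] := set_0Vmem T.
  rewrite cards0 subn0; suff <- : P0 = span_on finset.set0 x by [].
  apply: (chain_from_span_on _ chainP0); first by rewrite cards0 addn0.
  by move=> z /span_on0 ->; exact: ideal0 (prime_ideal (chain_from_prime chainP0)).
have Td : (#|T| <= d)%N by rewrite -[leqRHS]card_ord max_card.
have cT : #|T| = #|(T :\ j)%SET|.+1 by rewrite (cardsD1 j) Tj.
have := IHn (T :\ j)%SET; rewrite -ltnS -cT => /(_ Tn).
have -> : (d - #|(T :\ j)%SET| = (d - #|T|).+1)%N by lia.
move=> /(chain_from_shift (Mx j))[Q [TQ Qj cQ]].
have iQ := prime_ideal (chain_from_prime cQ).
suff <- : Q = span_on T x by [].
apply: (chain_from_span_on _ cQ); first by lia.
apply: span_on_min => // k Tk; have [-> //|kj] := eqVneq k j.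
by apply: (properW TQ); apply: mem_span_on; rewrite !inE kj.
Qed.

Lemma span_on_prime T : is_prime (span_on T x).
Proof. exact: chain_from_prime (span_on_chain T). Qed.

(** Otherwise the prime strictly above [span_on T x] supplied by [chain_from_shift] would be
    contained in it. *)
Lemma notin_span_on T j : j \notin T -> ~ span_on T x (x j).
Proof.
move=> Tj sj.
have cT : #|(j |: T)%SET| = #|T|.+1 by rewrite cardsU1 Tj.
have Td : (#|(j |: T)%SET| <= d)%N by rewrite -[leqRHS]card_ord max_card.
have := span_on_chain T.
have -> : (d - #|T| = (d - #|(j |: T)%SET|).+1)%N by lia.
move=> /(chain_from_shift (Mx j))[Q [TQ Qj cQ]].
have iQ := prime_ideal (chain_from_prime cQ).
have QE : Q = span_on (j |: T)%SET x.
  apply: (chain_from_span_on _ cQ); first by lia.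
  apply: span_on_min => // k; rewrite !inE => /predU1P[-> //|Tk].
  by apply: (properW TQ); exact: mem_span_on.
have [_] := TQ; apply; rewrite QE.
apply: span_on_min; first exact: span_on_ideal.
by move=> k; rewrite !inE => /predU1P[-> //|Tk]; exact: mem_span_on.
Qed.

(** When all exponents are [1], the ideal is a prime without [x j]. Otherwise pick [k] with
    [b = a k > 1] and let [U] be [T] without [k]: [S / (U, x_k^b)] is an extension of
    [S / (U, x_k^(b-1))] by [S / (U, x_k)], and [x j] is regular on both by induction on the number
    of parameters plus the sum of exponents. *)
Lemma span_on_pow_regular T a j r : (forall k, 0 < a k)%N -> j \notin T ->
  span_on T (fun k => x k ^+ a k) (x j * r) -> span_on T (fun k => x k ^+ a k) r.
Proof.
have [n] := ubnP (#|T| + \sum_(k in T) a k).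
elim: n => // n IHn in T a j r *; rewrite ltnS => Tn a_gt0 Tj.
pose f (a : 'I_d -> nat) k := x k ^+ a k; rewrite -/(f a).
have [/existsP[k /andP[Tk ak]]|] := boolP [exists k, (k \in T) && (1 < a k)%N]; last first.
  rewrite negb_exists => /forallP a1.
  have -> : span_on T (f a) = span_on T x.
    apply: eq_span_on => k Tk; rewrite /f; have := a1 k; have := a_gt0 k.
    by rewrite Tk /=; case: (a k) => [|[|]].
  by have [_ _ /[apply]] := span_on_prime T; case=> // /(notin_span_on Tj).
pose U := (T :\ k)%SET; have Uk : k \notin U by rewrite !inE eqxx.
have TE : T = (k |: U)%SET by rewrite finset.setD1K.
pose upd b i := if i == k then b else a i.
have updU b : span_on U (f (upd b)) = span_on U (f a).
  apply: eq_span_on => i; rewrite !inE => /andP[/negPf ik _].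
  by rewrite /f /upd ik.
have fk b : f (upd b) k = x k ^+ b by rewrite /f /upd eqxx.
have sumT (b : 'I_d -> nat) : (#|T| + \sum_(i in T) b i = #|U| + \sum_(i in U) b i + (b k).+1)%N.
  by rewrite TE cardsU1 Uk big_setU1 //=; lia.
have sumU b : (\sum_(i in U) upd b i = \sum_(i in U) a i)%N.
  apply: eq_bigr => i; rewrite !inE => /andP[/negPf ik _].
  by rewrite /upd ik.
have IHT b s : (0 < b < a k)%N -> span_on T (f (upd b)) (x j * s) ->
    span_on T (f (upd b)) s.
  move=> /andP[b0 ba]; apply: IHn => //.
    by apply: leq_trans Tn; rewrite !sumT sumU /upd eqxx; lia.
  by move=> i; rewrite /upd; case: ifP.
have IHU e s : span_on U (f a) (x k ^+ e * s) -> span_on U (f a) s.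
  elim: e => [|e IHe]; first by rewrite mul1r.
  rewrite exprS -mulrA => /IHn IHk; apply: IHe; apply: IHk => //.
  by apply: leq_trans Tn; rewrite sumT; lia.
have TE' b : span_on T (f b) = ideal_adjoin (span_on U (f b)) (f b k).
  by rewrite TE span_onU1.
have iU := span_on_ideal U (f a).
rewrite TE' => -[w' [t [Uw' e1]]].
have : span_on T (f (upd (a k).-1)) (x j * r).
  rewrite TE' updU fk; exists w', (t * x k); split=> //.
  by rewrite e1 /f -mulrA -exprS prednK.
have akE : f a k = x k * x k ^+ (a k).-1 by rewrite /f -exprS prednK.
have ak1 : (0 < (a k).-1 < a k)%N by lia.
(* Now [r = w + s x_k^(b-1)], where [b = a k]. Cancelling [x_k^(b-1)] modulo [U] leaves
   [x_j s - t x_k] in [U], so [x_j s], and then [s], lies in [U + (x_k)]. *)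
move/(IHT _ _ ak1); rewrite TE' updU fk => -[w [s [Uw e2]]].
have : span_on U (f a) (x k ^+ (a k).-1 * (x j * s - t * x k)).
  have -> : x k ^+ (a k).-1 * (x j * s - t * x k) = w' - x j * w.
    have -> : w' = x j * r - t * f a k by rewrite e1 addrK.
    by rewrite e2 akE; ring.
  by apply: idealB => //; exact: ideal_mull.
move/IHU => Uxs.
have : span_on T (f (upd 1%N)) (x j * s).
  rewrite TE' updU fk; exists (x j * s - t * x k), t; split=> //.
  by rewrite subrK.
move/(IHT 1%N _ ak) => {Uxs}; rewrite TE' updU fk => -[v [q [Uv e3]]].
exists (w + x k ^+ (a k).-1 * v), q; split; first by apply: idealD => //; exact: ideal_mull.
by rewrite e2 e3 akE; ring.
Qed.

End RegularLocal.

(** * Freeness over the [p]-th powers in a regular local ring *)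

Section FrobeniusFree.
Variables (p : nat) (S : comNzRingType) (charSp : p \in [pchar S]).

(** For a minimal generating family, a relation modulo [(x_k^p : k < i)] has its coefficients in
    [(x_k : k < i)]. Minimality gives the case [i = d], and regularity of the powers lowers [i] to
    [0], which is freeness. *)
Lemma local_frobenius_free : F_finite p S -> regular_local S ->
  exists n (u : 'I_n -> S), (forall y, exists c, y = \sum_(i < n) c i ^+ p * u i) /\
    forall c, \sum_(i < n) c i ^+ p * u i = 0 -> forall i, c i = 0.
Proof.
move=> finS [noeS [M [maxM locM [d [[[P chP] _] [x genM]]]]]].
have p_gt0 : (0 < p)%N by apply/prime_gt0/(pcharf_prime charSp).
have chP0 := prime_chain_from chP.
have pM := maximal_prime maxM; have iM := prime_ideal pM.
have Mx k : M (x k) by rewrite genM; apply: sub_idealgen; exists k.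
pose gen n := exists u : 'I_n -> S, forall y, exists c, y = \sum_(i < n) c i ^+ p * u i.
have drop n (u b : 'I_n -> S) j : (forall y, exists c, y = \sum_(i < n) c i ^+ p * u i) ->
    \sum_(i < n) b i ^+ p * u i = 0 -> b j = 1 -> gen n.-1.
  case: n => [|n] in u b j *; first by case: j.
  move=> uP b0 bj; exists (fun i => u (lift j i)) => y; have [a yE] := uP y.
  exists (fun i => a (lift j i) - a j * b (lift j i)).
  have {1}-> : y = \sum_(i < n.+1) (a i - a j * b i) ^+ p * u i.
    transitivity (\sum_(i < n.+1) a i ^+ p * u i - a j ^+ p * \sum_(i < n.+1) b i ^+ p * u i).
      by rewrite b0 mulr0 subr0.
    rewrite mulr_sumr -sumrB; apply: eq_bigr => i _; rewrite -!(pFrobenius_autE charSp) rmorphB rmorphM.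
    by rewrite mulrBl mulrA.
  by rewrite (bigD1_ord j) //= bj mulr1 subrr expr0n eqn0Ngt p_gt0 mul0r add0r.
have exgen : exists n, `[< gen n >].
  by case: finS => n [u uP]; exists n; apply/asboolP; exists u.
case: (ex_minnP exgen) => n /asboolP[u uP] minn.
exists n, u; split=> //.
pose J i : {set 'I_d} := [set k : 'I_d | (k < i)%N]%SET.
pose xp k := x k ^+ p.
have sumfD (c c' : 'I_n -> S) : \sum_(i < n) (c i + c' i) ^+ p * u i =
    \sum_(i < n) c i ^+ p * u i + \sum_(i < n) c' i ^+ p * u i.
  rewrite -big_split; apply: eq_bigr => i _.
  by rewrite -!(pFrobenius_autE charSp) rmorphD mulrDl.
have sumfZ b (c : 'I_n -> S) : \sum_(i < n) (b * c i) ^+ p * u i =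
    b ^+ p * \sum_(i < n) c i ^+ p * u i.
  by rewrite mulr_sumr; apply: eq_bigr => i _; rewrite exprMn mulrA.
have sumfN (c : 'I_n -> S) : \sum_(i < n) (- c i) ^+ p * u i =
    - \sum_(i < n) c i ^+ p * u i.
  rewrite -sumrN; apply: eq_bigr => i _.
  by rewrite -!(pFrobenius_autE charSp) rmorphN mulNr.
(* Correcting the [c i] by elements of [M] turns this into an exact relation; a coefficient outside
   [M] would be a unit and make [u j] redundant. *)
have top c j : span_on finset.setT xp (\sum_(i < n) c i ^+ p * u i) -> M (c j).
  move=> [e eE]; apply: contrapT => Mcj.
  have [g gP] := choice (fun k => uP (e k)).
  pose m i := \sum_(k in finset.setT) g k i * x k.
  have Mm i : M (m i) by apply: ideal_sum => // k _; exact: ideal_mull.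
  have c_m : \sum_(i < n) (c i - m i) ^+ p * u i = 0.
    rewrite sumfD sumfN eE; apply/eqP; rewrite subr_eq0; apply/eqP.
    transitivity (\sum_(k in finset.setT) \sum_(i < n) (g k i * x k) ^+ p * u i).
      apply: eq_bigr => k _; rewrite [in LHS]gP mulr_suml; apply: eq_bigr => i _.
      by rewrite exprMn mulrAC.
    rewrite exchange_big; apply: eq_bigr => i _.
    by rewrite /m (sum_expp _ _ _ charSp) mulr_suml.
  have [|v vE] := local_unit noeS locM (s := c j - m j).
    by move=> Mcm; apply: Mcj; rewrite -(subrK (m j) (c j)); apply: idealD.
  suff /asboolP/minn : gen n.-1 by rewrite leqNgt prednK ?leqnn //; exact: leq_ltn_trans (ltn_ord j).
  apply: (@drop n u (fun i => v * (c i - m i)) j uP) => //.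
  by rewrite sumfZ c_m mulr0.
have K i c j : (i <= d)%N -> span_on (J i) xp (\sum_(i < n) c i ^+ p * u i) ->
    span_on (J i) x (c j).
  move=> le_id; rewrite -(subKn le_id); elim: (d - i)%N c j (leq_subr i d) => {i le_id}[|i IHi] c j.
    rewrite subn0 => _; have -> : J d = finset.setT by apply/setP => k; rewrite !inE ltn_ord.
    by move=> /(top _ j); exact: (max_span_on genM).
  move=> lt_id; set i' := (d - i.+1)%N.
  have lt_i'd : (i' < d)%N by rewrite /i'; lia.
  pose k := Ordinal lt_i'd.
  have Jk : k \notin J i' by rewrite inE ltnn.
  have JS : J (d - i)%N = (k |: J i')%SET.
    apply/setP => l; rewrite !inE -val_eqE /= /i'.
    by apply/idP/idP; lia.
  have iJ := span_on_ideal (J i') x; have iJp := span_on_ideal (J i') xp.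
  (* All [j]-th coefficients of relations at this level. Writing [c = a + b x_k] and cancelling
     [x_k^p] makes [b] again such a relation, so [I] is contained in the span plus [x_k I]. *)
  pose I : set S := [set z | exists c, span_on (J i') xp (\sum_(i < n) c i ^+ p * u i) /\ z = c j].
  have iI : is_ideal I.
    split=> [|_ _ [c1 [Jc1 ->]] [c2 [Jc2 ->]]|b _ [c1 [Jc1 ->]]].
    - exists (fun=> 0); rewrite big1 => [|l _]; last by rewrite expr0n eqn0Ngt p_gt0 mul0r.
      by split=> //; exact: ideal0.
    - by exists (fun i => c1 i + c2 i); rewrite sumfD; split=> //; exact: idealD.
    - by exists (fun i => b * c1 i); rewrite sumfZ; split=> //; exact: ideal_mull.
  suff IJ : I `<=` sat M (span_on (J i') x).
    move=> Jc; apply: (local_saturated noeS locM iJ).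
    by apply: IJ; exists c.
  apply: (nakayama noeS pM iI iJ (Mx k)) => _ [{}c [Jc ->]].
  have Jc1 l : ideal_adjoin (span_on (J i') x) (x k) (c l).
    rewrite -span_onU1 // -JS; apply: IHi; first exact: ltnW.
    by rewrite JS span_onU1 //; exact: sub_ideal_adjoin.
  have [a aP] := choice Jc1; have [b abP] := choice aP.
  exists 1, (b j); split; first exact: primeN1.
  - exists b; split=> //.
    have reg e s : span_on (J i') xp (x k ^+ e * s) -> span_on (J i') xp s.
      elim: e => [|e IHe]; first by rewrite mul1r.
      rewrite exprS -mulrA => h; apply: IHe; move: h.
      exact: (span_on_pow_regular noeS maxM locM genM chP0 (a := fun=> p)).
    apply: (reg p); rewrite -sumfZ.
    have -> : \sum_(i < n) (x k * b i) ^+ p * u i =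
       \sum_(i < n) c i ^+ p * u i - \sum_(i < n) a i ^+ p * u i.
      rewrite -sumfN -sumfD; apply: eq_bigr => l _.
      by have [_ ->] := abP l; rewrite addrAC subrr add0r (mulrC (x k)).
    apply: (idealB iJp) => //; apply: (ideal_sum _ iJp) => l _; apply: (ideal_mulr _ iJp).
    have [[e ->] _] := abP l; exists (fun k => e k ^+ p).
    rewrite (sum_expp _ _ _ charSp); apply: eq_bigr => q _.
    by rewrite exprMn.
  - by have [Ja ->] := abP j; rewrite mul1r (mulrC (x k)) addrK.
move=> c c0 j; have J0 : J 0%N = finset.set0 by apply/setP => k; rewrite !inE.
apply: (@span_on0 _ _ x); rewrite -J0; apply: K => //.
by rewrite c0; apply: ideal0; exact: span_on_ideal.
Qed.

(* The equational criterion for flatness of the Frobenius, for one equation. *)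
Lemma local_frobenius_flat_row : F_finite p S -> regular_local S ->
  forall N (a y : 'I_N -> S), \sum_(j < N) a j ^+ p * y j = 0 ->
  exists n (u : 'I_n -> S) (c : 'I_n -> 'I_N -> S),
    (forall i, \sum_(j < N) a j * c i j = 0) /\
    forall j, y j = \sum_(i < n) u i * c i j ^+ p.
Proof.
move=> finS regS N a y ay; have [n [u [uP ufree]]] := local_frobenius_free finS regS.
have [c cP] := choice (fun j => uP (y j)).
exists n, u, (fun i j => c j i); split=> [i|j]; last first.
  by rewrite [LHS]cP; apply: eq_bigr => i _; rewrite mulrC.
apply: (ufree (fun i => \sum_(j < N) a j * c j i)); rewrite -[RHS]ay.
under eq_bigr do rewrite (sum_expp _ _ _ charSp) mulr_suml.
rewrite exchange_big; apply: eq_bigr => j _; rewrite [y j]cP mulr_sumr.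
by apply: eq_bigr => k _; rewrite exprMn mulrA.
Qed.

End FrobeniusFree.

Lemma tofrac_sum (R : idomainType) (I : finType) (F : I -> R) :
  tofrac (\sum_i F i) = \sum_i tofrac (F i).
Proof. exact: (big_morph _ (@tofracD R) (@tofrac0 R)). Qed.

(** * Transfer of the hypotheses to localizations *)

Section LocalizationTheory.
Variables (p : nat) (R : idomainType) (P : primeIdeal R).
Local Notation L := (localization P).
Local Notation Q := (prime_carrier P).

Lemma loc_valD (z w : L) : loc_val (z + w) = loc_val z + loc_val w.
Proof. by []. Qed.

Lemma loc_valM (z w : L) : loc_val (z * w) = loc_val z * loc_val w.
Proof. by []. Qed.

Lemma loc_val0 : loc_val (0 : L) = 0.
Proof. by []. Qed.

Lemma loc_valX (z : L) n : loc_val (z ^+ n) = loc_val z ^+ n.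
Proof. by elim: n => [//|n IHn]; rewrite !exprS loc_valM IHn. Qed.

Lemma loc_val_sum (I : finType) (F : I -> L) :
  loc_val (\sum_i F i) = \sum_i loc_val (F i).
Proof. exact: (big_morph _ loc_valD loc_val0). Qed.

Lemma loc_frac (a b : R) : ~ Q b -> exists z : L, loc_val z = tofrac a / tofrac b.
Proof.
move=> Qb; have abP : tofrac a / tofrac b \in loc_pred P.
  by apply/asboolP; exists a, b.
by exists (Localization abP).
Qed.

Lemma loc_tofrac (a : R) : exists z : L, loc_val z = tofrac a.
Proof.
have [|z zE] := @loc_frac a 1; first exact: primeN1 (primeIdealP P).
by exists z; rewrite zE tofrac1 divr1.
Qed.

Lemma loc_valE (z : L) : exists a b, ~ Q b /\ loc_val z = tofrac a / tofrac b.
Proof. by have /asboolP[a [b [Qb e]]] := loc_valP z; exists a, b. Qed.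

Lemma tofrac_neq0 b : ~ Q b -> tofrac b != 0.
Proof.
move=> Qb; rewrite tofrac_eq0; apply/eqP => b0; apply: Qb; rewrite b0.
exact: ideal0 (prime_ideal (primeIdealP P)).
Qed.

Lemma common_denominator (T : finType) (z : T -> L) : exists s (w : T -> R), ~ Q s /\
  forall i, tofrac s * loc_val (z i) = tofrac (w i).
Proof.
have [a aP] := choice (fun i => loc_valE (z i)); have [b abP] := choice aP.
have prodNQ : ~ Q (\prod_i b i).
  apply: (big_ind (fun s => ~ Q s)) => [|x y Qx Qy|i _]; last by case: (abP i).
    exact: primeN1 (primeIdealP P).
  exact: primeNM (primeIdealP P) _ _.
exists (\prod_i b i), (fun i => a i * \prod_(k | k != i) b k); split=> // i.
have [Qbi ->] := abP i; rewrite (bigD1 i) //= !tofracM mulrC mulrA divfK //.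
exact: tofrac_neq0.
Qed.

Lemma pchar_localization : p \in [pchar R] -> p \in [pchar L].
Proof.
move=> /andP[prp /eqP p0]; rewrite inE prp /=; apply/eqP/val_inj.
have -> : val (p%:R : L) = tofrac (p%:R : R).
  by rewrite rmorph_nat; elim: p => [|n IHn]; rewrite ?tofrac0 // -!natr1 tofracD tofrac1 IHn.
by rewrite p0 tofrac0.
Qed.

Lemma F_finite_localization : (0 < p)%N -> F_finite p R -> F_finite p L.
Proof.
move=> p_gt0 [n [g gP]]; have [h hP] := choice (fun i => loc_tofrac (g i)).
exists n, h => z; have [a [b [Qb zE]]] := loc_valE z.
(* Rewriting [a / b] as [a b^(p-1) / b^p] makes the denominator a [p]-th power. *)
have [c cE] := gP (a * b ^+ p.-1).
have [e eP] := choice (fun i => loc_frac (c i) Qb).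
exists e; apply: val_inj; rewrite [LHS]zE [RHS]loc_val_sum.
under eq_bigr => i _ do rewrite loc_valM loc_valX eP hP expr_div_n mulrAC -tofracXn -tofracM.
rewrite -mulr_suml -tofrac_sum -cE -tofracXn -{2}(prednK p_gt0) exprS !tofracM.
rewrite -mulf_div divff ?mulr1 // tofracXn expf_neq0 //; exact: tofrac_neq0.
Qed.

End LocalizationTheory.

(** * Flatness of the Frobenius over [R] *)

Section FrobeniusFlat.
Variables (p : nat) (R : idomainType) (charRp : p \in [pchar R]).
Hypotheses (R_Ffin : F_finite p R) (R_reg : regular_domain R).

Lemma frobenius_flat_row N (a y : 'I_N -> R) : \sum_(j < N) a j ^+ p * y j = 0 ->
  exists n (u : 'I_n -> R) (c : 'I_n -> 'I_N -> R),
    (forall i, \sum_(j < N) a j * c i j = 0) /\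
    forall j, y j = \sum_(i < n) u i * c i j ^+ p.
Proof.
move=> ay; have [noeR regR] := R_reg.
have p_gt0 : (0 < p)%N by apply/prime_gt0/(pcharf_prime charRp).
pose D : set R := [set d | exists n (u : 'I_n -> R) (c : 'I_n -> 'I_N -> R),
    (forall i, \sum_(j < N) a j * c i j = 0) /\
    forall j, d * y j = \sum_(i < n) u i * c i j ^+ p].
suff [n [u [c [ac yE]]]] : D 1.
  by exists n, u, c; split=> // j; rewrite -yE mul1r.
apply: contrapT => D1.
have iD : is_ideal D.
  split=> [|d d' [n [u [c [ac dE]]]] [n' [u' [c' [ac' dE']]]]|b d [n [u [c [ac dE]]]]].
  - exists 0%N, (fun=> 0), (fun _ _ => 0); split=> [[]//|j].
    by rewrite big_ord0 mul0r.
  - exists (n + n')%N, (fun i => match split i with inl k => u k | inr k => u' k end).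
    exists (fun i => match split i with inl k => c k | inr k => c' k end).
    split=> [i|j]; first by case: (split i).
    rewrite mulrDl dE dE' big_split_ord /=.
    congr (_ + _); apply: eq_bigr => i _; first by rewrite (unsplitK (inl i)).
    by rewrite (unsplitK (inr i)).
  - exists n, (fun i => b * u i), c; split=> // j.
    by rewrite -mulrA dE mulr_sumr; apply: eq_bigr => i _; rewrite mulrA.
have [M [mM DM]] := proper_sub_maximal noeR iD D1.
pose P := PrimeIdeal (maximal_prime mM).
have [A AE] := choice (fun j => loc_tofrac P (a j)).
have [Y YE] := choice (fun j => loc_tofrac P (y j)).
have [|n [U [C [AC YUC]]]] := local_frobenius_flat_row (pchar_localization P charRp)
    (F_finite_localization P p_gt0 R_Ffin) (regR P) (a := A) (y := Y).
  apply: val_inj; rewrite [LHS]loc_val_sum [RHS]loc_val0.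
  under eq_bigr => j _ do rewrite loc_valM loc_valX AE YE -tofracXn -tofracM.
  by rewrite -tofrac_sum ay tofrac0.
have [s [w [Ms wE]]] := common_denominator U.
have [t [c [Mt cE]]] := common_denominator (fun ij => C ij.1 ij.2).
(* The denominator [t] of the solutions [C] enters as [t ^+ p], because [C] occurs through [p]-th
   powers. *)
suff /DM : D (s * t ^+ p).
  apply: (primeNM (maximal_prime mM)) => // /prime_exp Mtp.
  by apply: Mt; apply: Mtp; exact: maximal_prime.
exists n, w, (fun i j => c (i, j)); split=> [i|j].
  apply/eqP; rewrite -tofrac_eq0 tofrac_sum; apply/eqP.
  under eq_bigr => j _ do rewrite tofracM -cE /= mulrCA -AE -loc_valM.
  by rewrite -mulr_sumr -loc_val_sum AC mulr0.
apply/eqP; rewrite -tofrac_eq !tofracM tofracXn -YE YUC loc_val_sum mulr_sumr.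
rewrite tofrac_sum; apply/eqP/eq_bigr => i _.
by rewrite tofracM tofracXn -wE -cE loc_valM loc_valX exprMn mulrACA.
Qed.

End FrobeniusFlat.

(** * Linear systems and iterated Frobenius *)

Lemma sum_expq (p e : nat) (S : comNzRingType) (I : Type) (r : seq I) (P : pred I) (F : I -> S) :
  p \in [pchar S] -> (\sum_(i <- r | P i) F i) ^+ (p ^ e) = \sum_(i <- r | P i) F i ^+ (p ^ e).
Proof.
move=> charSp; elim: e => [|e IHe]; first by rewrite expr1; apply: eq_bigr => i _; rewrite expr1.
rewrite expnSr exprM IHe (sum_expp _ _ _ charSp).
by apply: eq_bigr => i _; rewrite -exprM.
Qed.

Definition mxfrob (R : pzSemiRingType) (q m n : nat) (A : 'M[R]_(m, n)) : 'M[R]_(m, n) :=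
  map_mx (fun x => x ^+ q) A.

Section FrobeniusFlatMatrix.
Variables (p : nat) (R : idomainType) (charRp : p \in [pchar R]).
Hypotheses (R_Ffin : F_finite p R) (R_reg : regular_domain R).

Let p_gt0 : (0 < p)%N. Proof. exact/prime_gt0/(pcharf_prime charRp). Qed.

Lemma mxfrob_mul e m n k (A : 'M[R]_(m, n)) (B : 'M_(n, k)) :
  mxfrob (p ^ e) (A *m B) = mxfrob (p ^ e) A *m mxfrob (p ^ e) B.
Proof.
apply/matrixP => i j; rewrite !mxE (sum_expq _ _ _ _ charRp).
by apply: eq_bigr => l _; rewrite !mxE exprMn.
Qed.

Lemma mxfrob1 q n : (0 < q)%N -> mxfrob q (1%:M : 'M[R]_n) = 1%:M.
Proof.
move=> q0; apply/matrixP => i j; rewrite !mxE.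
by case: (i == j); rewrite ?expr1n // expr0n eqn0Ngt q0.
Qed.

(** Rows are solved one at a time: the first row writes [y] as [mxfrob p Y *m b], and the other rows
    become equations for [b]. *)
Lemma frobenius_flat_col m N (A : 'M[R]_(m, N)) (y : 'cV_N) : mxfrob p A *m y = 0 ->
  exists n (Y : 'M[R]_(N, n)) (b : 'cV_n), A *m Y = 0 /\ y = mxfrob p Y *m b.
Proof.
elim: m N A y => [|m IHm] N A y Ay.
  exists N, 1%:M, y; rewrite mxfrob1 // mul1mx; split=> //.
  by apply/matrixP => -[].
rewrite -[m.+1]/(1 + m)%N in A Ay *.
move: Ay; rewrite -[A]vsubmxK; set a := usubmx A; set A' := dsubmx A.
move=> Ay; have /eq_col_mx[ay {}Ay] :
    col_mx (mxfrob p a *m y) (mxfrob p A' *m y) = col_mx 0 0.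
  by rewrite -mul_col_mx -map_col_mx col_mx0.
have [|n [u [c [ac yE]]]] := frobenius_flat_row charRp R_Ffin R_reg
    (a := fun j => a 0 j) (y := fun j => y j 0).
  have /matrixP/(_ 0 0) := ay; rewrite !mxE => e; rewrite -[RHS]e.
  by apply: eq_bigr => j _; rewrite !mxE.
pose Y : 'M_(N, n) := \matrix_(j, i) c i j; pose b : 'cV_n := \col_i u i.
have frobM k (C : 'M_(n, k)) : mxfrob p (Y *m C) = mxfrob p Y *m mxfrob p C.
  by have := mxfrob_mul 1 Y C; rewrite expn1.
have yYb : y = mxfrob p Y *m b.
  apply/matrixP => j k; rewrite ord1 yE !mxE; apply: eq_bigr => i _.
  by rewrite !mxE mulrC.
have aY : a *m Y = 0.
  apply/matrixP => k i; rewrite ord1 !mxE -[RHS](ac i).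
  by apply: eq_bigr => j _; rewrite !mxE.
have [|n' [Z [b' [AZ bE]]]] := IHm n (A' *m Y) b.
  by have := mxfrob_mul 1 A' Y; rewrite expn1 => ->; rewrite -mulmxA -yYb.
exists n', (Y *m Z), b'; split.
  by rewrite mul_col_mx !mulmxA aY mul0mx AZ col_mx0.
by rewrite frobM -mulmxA -bE.
Qed.

(** Several columns are needed because iterating over [e] solves again for a whole matrix of
    solutions. *)
Lemma frobenius_flat_mx m N l (A : 'M[R]_(m, N)) (y : 'M_(N, l)) : mxfrob p A *m y = 0 ->
  exists n (Y : 'M[R]_(N, n)) (B : 'M_(n, l)), A *m Y = 0 /\ y = mxfrob p Y *m B.
Proof.
elim: l y => [|l IHl] y Ay.
  exists 0%N, 0, 0; split; first by rewrite mulmx0.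
  by apply/matrixP => i [].
rewrite -[l.+1]/(1 + l)%N in y Ay *.
move: Ay; rewrite -[y]hsubmxK mul_mx_row -row_mx0 => /eq_row_mx[Ay1 Ay2].
have [n [Y [b [AY ->]]]] := frobenius_flat_col Ay1.
have [n' [Y' [B [AY' ->]]]] := IHl _ Ay2.
exists (n + n')%N, (row_mx Y Y'), (block_mx b 0 0 B); split.
  by rewrite mul_mx_row AY AY' row_mx0.
by rewrite /mxfrob map_row_mx mul_row_block !mulmx0 addr0 add0r.
Qed.

Lemma frobenius_flat e m N l (A : 'M[R]_(m, N)) (y : 'M_(N, l)) :
  mxfrob (p ^ e) A *m y = 0 ->
  exists n (Y : 'M[R]_(N, n)) (B : 'M_(n, l)), A *m Y = 0 /\ y = mxfrob (p ^ e) Y *m B.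
Proof.
have frobS k k' e' (C : 'M[R]_(k, k')) : mxfrob (p ^ e'.+1) C = mxfrob (p ^ e') (mxfrob p C).
  by apply/matrixP => i j; rewrite !mxE expnS exprM.
elim: e m N l A y => [|e IHe] m N l A y.
  have frob1 k k' (C : 'M[R]_(k, k')) : mxfrob (p ^ 0) C = C.
    by apply/matrixP => i j; rewrite !mxE expr1.
  by rewrite frob1 => Ay; exists l, y, 1%:M; rewrite frob1 mulmx1.
rewrite frobS => /IHe[n [Y [B [/frobenius_flat_mx[n' [Z [C [AZ ->]]]] ->]]]].
by exists n', Z, (mxfrob (p ^ e) C *m B); rewrite frobS mxfrob_mul mulmxA.
Qed.

(** Flatness applied to [x^q - \sum_i c_i h_i^q = 0] expresses the coefficient [1] of [x^q] as a
    combination of powers [y^q] with [x y] in [I]; multiplying by [x] gives the claim. *)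
Lemma frob_pow_q_faithful e (I : set R) x : is_ideal I ->
  frob_pow_q (p ^ e) I (x ^+ (p ^ e)) -> I x.
Proof.
set q := (p ^ e)%N => iI /idealgen_sum[n [c [f [fP xE]]]].
have q_gt0 : (0 < q)%N by rewrite expn_gt0 p_gt0.
have {}fP i : exists h, I h /\ h ^+ q = f i by case: (fP i) => h Ih <-; exists h.
have [h hP] := choice fP.
pose A : 'rV[R]_(1 + n) := row_mx x%:M (\row_i h i).
pose y : 'cV[R]_(1 + n) := col_mx 1%:M (\col_i - c i).
have [|k [Y [B [AY yE]]]] := @frobenius_flat e _ _ _ A y.
  rewrite -/q /mxfrob map_row_mx mul_row_col mulmx1; apply/matrixP => i j.
  rewrite !ord1 !mxE /= mulr1n xE -big_split /= big1 // => l _.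
  by rewrite !mxE; have [_ ->] := hP l; rewrite mulrN mulrC subrr.
have IY l : I (x * Y (lshift n 0) l).
  have /matrixP/(_ 0 l) := AY; rewrite !mxE big_split_ord big_ord1 /=.
  rewrite row_mxEl !mxE /= mulr1n => /eqP; rewrite addr_eq0 => /eqP->.
  apply: idealN => //; apply: ideal_sum => // i _; rewrite row_mxEr mxE.
  by apply: ideal_mulr => //; case: (hP i).
have /matrixP/(_ (lshift n 0) 0) := yE.
rewrite col_mxEu !mxE eqxx mulr1n => e1; rewrite -[x]mulr1 e1 mulr_sumr.
apply: ideal_sum => // l _; rewrite mulrA; apply: ideal_mulr => //.
by rewrite mxE -/q -(prednK q_gt0) exprS mulrA; apply: ideal_mulr.
Qed.

End FrobeniusFlatMatrix.

(** * Coefficients of powers of the generic combination *)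

Section FrobeniusPowerTheory.
Variables (p : nat) (S : comNzRingType) (charSp : p \in [pchar S]).
Implicit Types (I J K X Y : set S) (x y : S).

Lemma frob_pow_q_ideal q I : is_ideal (frob_pow_q q I).
Proof. exact: idealgen_ideal. Qed.

Lemma mem_frob_pow_q q I x : I x -> frob_pow_q q I (x ^+ q).
Proof. by move=> Ix; apply: sub_idealgen; exists x. Qed.

Lemma frob_pow_q_min q I J : is_ideal J -> (forall x, I x -> J (x ^+ q)) ->
  frob_pow_q q I `<=` J.
Proof. by move=> iJ IJ; apply: idealgen_min => // _ [x Ix <-]; exact: IJ. Qed.

Lemma frob_pow_qS q I J : I `<=` J -> frob_pow_q q I `<=` frob_pow_q q J.
Proof.
by move=> IJ; apply: frob_pow_q_min (frob_pow_q_ideal _ _) _ => x /IJ; exact: mem_frob_pow_q.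
Qed.

Lemma frob_pow_q_gen e X : frob_pow_q (p ^ e) (idealgen X) `<=`
  idealgen [set x ^+ (p ^ e) | x in X].
Proof.
have iX := idealgen_ideal [set x ^+ (p ^ e) | x in X].
apply: frob_pow_q_min => // x /idealgen_sum[n [c [f [Xf ->]]]].
rewrite (sum_expq _ _ _ _ charSp); apply: (ideal_sum _ iX) => i _.
rewrite exprMn; apply: (ideal_mull _ iX).
by apply: sub_idealgen; exists (f i).
Qed.

Lemma ideal_mul_ideal I J : is_ideal (ideal_mul I J).
Proof. exact: idealgen_ideal. Qed.

Lemma mem_ideal_mul I J x y : I x -> J y -> ideal_mul I J (x * y).
Proof. by move=> Ix Jy; apply: sub_idealgen; exists x, y. Qed.

Lemma ideal_mul_min I J K : is_ideal K -> (forall x y, I x -> J y -> K (x * y)) ->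
  ideal_mul I J `<=` K.
Proof.
by move=> iK IJK; apply: idealgen_min => // _ [x [y [Ix Jy ->]]]; exact: IJK.
Qed.

Lemma ideal_mul_gen X Y K : is_ideal K -> (forall x y, X x -> Y y -> K (x * y)) ->
  forall x y, idealgen X x -> idealgen Y y -> K (x * y).
Proof.
move=> iK XYK x y /idealgen_sum[n [c [f [Xf ->]]]] /idealgen_sum[k [d [h [Yh ->]]]].
rewrite mulr_suml; apply: ideal_sum => // i _; rewrite mulr_sumr.
apply: ideal_sum => // j _; rewrite mulrACA; apply: ideal_mull => //.
exact: XYK.
Qed.

Lemma ideal_powS I n : ideal_pow I n.+1 = ideal_mul I (ideal_pow I n).
Proof. by []. Qed.

Lemma ideal_pow_principal x n : ideal_pow (idealgen [set x]) n = idealgen [set x ^+ n] :> set S.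
Proof.
elim: n => [|n IHn]; apply/seteqP; split=> y.
- by move=> _; apply/idealgen1P; exists y; rewrite mulr1.
- by [].
- rewrite ideal_powS IHn; move: y; apply: (ideal_mul_min (idealgen_ideal _)).
  apply: (ideal_mul_gen (idealgen_ideal _)) => _ _ -> ->.
  by rewrite -exprS; apply: sub_idealgen.
- move=> /idealgen1P[r ->]; rewrite ideal_powS IHn.
  apply: (ideal_mull _ (ideal_mul_ideal _ _)).
  by rewrite exprS; apply: mem_ideal_mul; exact: sub_idealgen.
Qed.

Lemma digit_sum n k : (1 < p)%N -> (k < p ^ n)%N -> k = (\sum_(i < n) digit p k i * p ^ i)%N.
Proof.
move=> p_gt1; have p_gt0 := ltnW p_gt1.
elim: n k => [|n IHn] k; first by rewrite expn0 ltnS leqn0 big_ord0 => /eqP.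
rewrite expnS => lt_k; rewrite big_ord_recl /= /digit expn0 divn1 muln1.
rewrite {1}(divn_eq k p) addnC; congr (_ + _)%N.
rewrite {1}(IHn (k %/ p)%N) ?ltn_divLR 1?mulnC // big_distrr /=.
by apply: eq_bigr => i _; rewrite /digit /bump add1n expnS divnMA mulnCA.
Qed.

End FrobeniusPowerTheory.

(** * Content ideals and extended ideals *)

Section Content.
Variables (m : nat) (R : comNzRingType).
Implicit Types (F H : {mpoly R[m]}) (I J : set R).

Definition content F : set R := idealgen [set F@_u | u in setT].

Definition mext I : set {mpoly R[m]} := idealgen [set c%:MP_[m] | c in I].

Lemma mcoeff_content F u : content F F@_u.
Proof. by apply: sub_idealgen; exists u. Qed.

Lemma content_min F I : is_ideal I -> (forall u, I F@_u) -> content F `<=` I.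
Proof. by move=> iI IF; apply: idealgen_min => // _ [u _ <-]. Qed.

Lemma mcoeff_ideal_mul I J F H u : (forall u, I F@_u) -> (forall u, J H@_u) ->
  ideal_mul I J (F * H)@_u.
Proof.
move=> IF JH; rewrite mcoeffM; apply: ideal_sum; first exact: ideal_mul_ideal.
by move=> k _; apply: mem_ideal_mul.
Qed.

Lemma content_mulr F H : content (F * H) `<=` content F.
Proof.
apply: content_min; first exact: idealgen_ideal.
move=> u; rewrite mcoeffM; apply: (ideal_sum _ (idealgen_ideal _)) => k _.
by apply: (ideal_mulr _ (idealgen_ideal _)); exact: mcoeff_content.
Qed.

Lemma mextP I F : is_ideal I -> mext I F <-> forall u, I F@_u.
Proof.
move=> iI; split=> [|IF]; last first.
  rewrite (mpolyE F); apply: (ideal_sum _ (idealgen_ideal _)) => u _.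
  rewrite -mul_mpolyC; apply: (ideal_mulr _ (idealgen_ideal _)).
  by apply: sub_idealgen; exists F@_u.
suff : mext I `<=` [set F | forall u, I F@_u] by apply.
apply: idealgen_min => [|_ [c Ic <-] u]; last by rewrite mcoeffC; exact: ideal_mulr.
split=> [u|F1 F2 IF1 IF2 u|F1 F2 IF2 u].
- by rewrite mcoeff0; exact: ideal0.
- by rewrite mcoeffD; exact: idealD.
- by rewrite mcoeffM; apply: ideal_sum => // k _; exact: ideal_mull.
Qed.

Lemma mext_ideal I : is_ideal (mext I). Proof. exact: idealgen_ideal. Qed.

Lemma mem_mext I c : I c -> mext I c%:MP.
Proof. by move=> Ic; apply: sub_idealgen; exists c. Qed.

Lemma mpolyC_preimage_ideal (C : set {mpoly R[m]}) : is_ideal C ->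
  is_ideal [set c | C c%:MP].
Proof.
move=> iC; split=> /= [|c d Cc Cd|b c Cc].
- by rewrite mpolyC0; exact: ideal0.
- by rewrite mpolyCD; exact: idealD.
- by rewrite mpolyCM; exact: ideal_mull.
Qed.

End Content.

Section FrobeniusContent.
Variables (p m : nat) (R : idomainType) (charRp : p \in [pchar R]).
Implicit Types (F H : {mpoly R[m]}) (I J : set R).

Let p_gt0 : (0 < p)%N. Proof. exact/prime_gt0/(pcharf_prime charRp). Qed.

Lemma pchar_mpoly : p \in [pchar {mpoly R[m]}].
Proof. by move: charRp; rewrite !inE -mpolyC_nat mpolyC_eq0. Qed.

Lemma mcoeff_monomial_mul_expq e c w F k : (c *: 'X_[w] * F ^+ (p ^ e))@_k =
  c * \sum_(t <- msupp F) F@_t ^+ (p ^ e) * (w + t *+ (p ^ e) == k)%MM%:R.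
Proof.
rewrite [F in LHS]mpolyE (sum_expq _ _ _ _ pchar_mpoly) -scalerAl mcoeffZ; congr (_ * _).
rewrite mulr_sumr raddf_sum /=; apply: eq_bigr => t _.
by rewrite exprZn mpolyXn -scalerAr -mpolyXD mcoeffZ mcoeffX.
Qed.

Lemma mcoeff_msupp_sum (A : pzRingType) F (h : R -> A) t : h 0 = 0 ->
  \sum_(s <- msupp F) h F@_s * (s == t)%:R = h F@_t.
Proof.
move=> h0; have [tF|tF] := boolP (t \in msupp F).
  rewrite (bigD1_seq t) //= eqxx mulr1 big1 ?addr0 // => s /negPf->.
  by rewrite mulr0.
rewrite big_seq big1 => [|s sF]; first by move/memN_msupp_eq0: tF => ->.
by case: eqP sF tF => [-> -> //|_ _ _]; rewrite mulr0.
Qed.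

Lemma expq0 e : (0 : R) ^+ (p ^ e) = 0.
Proof. by rewrite expr0n expn_eq0 eqn0Ngt p_gt0. Qed.

Lemma mnm_muln_inj (s t : 'X_{1..m}) e : (s *+ (p ^ e) == t *+ (p ^ e))%MM = (s == t).
Proof.
apply/eqP/eqP => [/mnmP st|-> //]; apply/mnmP => i.
by apply/eqP; have := st i; rewrite !mulmnE => /eqP; rewrite eqn_pmul2r // expn_gt0 p_gt0.
Qed.

Lemma mcoeff_expq_muln e F t : (F ^+ (p ^ e))@_(t *+ (p ^ e)) = F@_t ^+ (p ^ e).
Proof.
have := mcoeff_monomial_mul_expq e 1 0%MM F (t *+ (p ^ e))%MM.
rewrite scale1r mpolyX0 !mul1r => ->.
rewrite -(mcoeff_msupp_sum F (h := fun x => x ^+ (p ^ e))) ?expq0 //.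
by apply: eq_bigr => s _; rewrite add0m mnm_muln_inj.
Qed.

Lemma mcoeff_expq e F k :
  (F ^+ (p ^ e))@_k = 0 \/ exists t, (F ^+ (p ^ e))@_k = F@_t ^+ (p ^ e).
Proof.
have [[t ->]|nk] := pselect (exists t, k = (t *+ (p ^ e))%MM).
  by right; exists t; rewrite mcoeff_expq_muln.
left; have := mcoeff_monomial_mul_expq e 1 0%MM F k.
rewrite scale1r mpolyX0 !mul1r => ->; rewrite big1 // => t _.
by case: eqP => [tk|]; [case: nk; exists t; rewrite -tk add0m | rewrite mulr0].
Qed.

Lemma content_expq e F :
  content (F ^+ (p ^ e)) = idealgen [set F@_t ^+ (p ^ e) | t in setT].
Proof.
apply/seteqP; split.
  apply: content_min => [|u]; first exact: idealgen_ideal.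
  have [->|[t ->]] := mcoeff_expq e F u; first exact: ideal0 (idealgen_ideal _).
  by apply: sub_idealgen; exists t.
apply: idealgen_min => [|_ [t _ <-]]; first exact: idealgen_ideal.
by rewrite -mcoeff_expq_muln; exact: mcoeff_content.
Qed.

Lemma frob_pow_q_content e F : frob_pow_q (p ^ e) (content F) `<=` content (F ^+ (p ^ e)).
Proof.
rewrite content_expq => x /(frob_pow_q_gen charRp).
by apply: idealgenS => _ [_ [u _ <-] <-]; exists u.
Qed.

Lemma mnm_euclid_uniq (u w v t : 'X_{1..m}) q : (forall i, u i < q)%N -> (forall i, w i < q)%N ->
  (w + t *+ q == u + v *+ q)%MM = (w == u) && (t == v).
Proof.
move=> uq wq; apply/eqP/andP => [/mnmP e|[/eqP-> /eqP->] //].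
have e' i : (w i + t i * q = u i + v i * q)%N by have := e i; rewrite !mnmDE !mulmnE.
have wu : w = u.
  apply/mnmP => i; have := congr1 (modn^~ q) (e' i).
  by rewrite ![(_ + _ * q)%N]addnC !modnMDl !modn_small.
rewrite wu eqxx; split=> //; apply/eqP/mnmP => i.
have q0 : (0 < q)%N by apply: leq_ltn_trans (uq i).
by have /eqP := e' i; rewrite wu eqn_add2l eqn_pmul2r // => /eqP.
Qed.

(** Division of exponents by [p ^ e] is unique, so no two products of a term of [F] with a term of
    [H ^+ (p ^ e)] collide. *)
Lemma mcoeff_mul_expq e F H (u v : 'X_{1..m}) : (forall w, w \in msupp F -> forall i, w i < p ^ e)%N ->
  (forall i, u i < p ^ e)%N ->
  (F * H ^+ (p ^ e))@_(u + v *+ (p ^ e)) = F@_u * H@_v ^+ (p ^ e).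
Proof.
move=> Fq uq; rewrite [F in LHS]mpolyE mulr_suml raddf_sum /=.
under eq_bigr => w _ do rewrite mcoeff_monomial_mul_expq.
have E w : w \in msupp F ->
  F@_w * (\sum_(t <- msupp H) H@_t ^+ (p ^ e) *
      (w + t *+ (p ^ e) == u + v *+ (p ^ e))%MM%:R) =
  F@_w * (w == u)%:R * H@_v ^+ (p ^ e).
  move=> /Fq wq; under eq_bigr => t _ do rewrite mnm_euclid_uniq // -mulnb natrM mulrCA.
  rewrite -mulr_sumr (mcoeff_msupp_sum H (h := fun x => x ^+ (p ^ e))) ?expq0 //.
  by rewrite mulrA.
rewrite big_seq (eq_bigr _ E) -big_seq -mulr_suml.
by rewrite (mcoeff_msupp_sum F (h := id)).
Qed.

End FrobeniusContent.

Section GenericCombination.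
Variables (p m : nat) (R : idomainType) (charRp : p \in [pchar R]) (g : 'I_m -> R).
Local Notation G := (generic_comb g).
Local Notation a := (idealgen (range g)).

Let prp : prime p. Proof. exact: (pcharf_prime charRp). Qed.
Let p_gt0 : (0 < p)%N. Proof. exact: prime_gt0. Qed.
Let p_gt1 : (1 < p)%N. Proof. exact: prime_gt1. Qed.

Lemma mcoeff_generic_comb u : G@_u = \sum_(i < m) (U_(i)%MM == u)%:R * g i.
Proof.
rewrite /generic_comb raddf_sum /=; apply: eq_bigr => i _.
by rewrite mulrC mcoeffCM mcoeffX mulrC.
Qed.

Lemma mcoeff_generic_combU i : G@_U_(i) = g i.
Proof.
rewrite mcoeff_generic_comb (bigD1 i) //= eqxx mul1r big1 ?addr0 // => j ji.
by rewrite -mcoeffX mcoeffXU (negPf ji) mul0r.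
Qed.

Lemma mderiv_generic_comb i : G^`M(i) = (g i)%:MP.
Proof.
rewrite /generic_comb raddf_sum /= (bigD1 i) //= big1 ?addr0 => [|j ji].
  by rewrite mulrC mderiv_mulC mderivX mnm1E eqxx scale1r -{1}[U_(i)%MM]add0m addmK mpolyX0 mulr1.
by rewrite mulrC mderiv_mulC mderivX mnm1E (negPf ji) scale0r mulr0.
Qed.

Lemma generic_comb_homog k : G ^+ k \is k.-homog.
Proof.
have G1 : G \is 1.-homog.
  apply: rpred_sum => i _; rewrite mulrC mul_mpolyC; apply: dhomogZ.
  by rewrite dhomogX /= mdeg1.
by have := dhomogMn k G1; rewrite mul1n.
Qed.

Lemma msupp_generic_comb_exp k u : u \in msupp (G ^+ k) -> mdeg u = k.
Proof. by move=> uG; exact: (dhomog_mf (generic_comb_homog k)). Qed.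

Lemma mnm_le_mdeg (u : 'X_{1..m}) i : (u i <= mdeg u)%N.
Proof. by rewrite mdegE (bigD1 i) //= leq_addr. Qed.

Lemma mcoeff_generic_comb_exp k u : ideal_pow a k (G ^+ k)@_u.
Proof.
elim: k u => [//|k IHk] u; rewrite exprS ideal_powS; apply: mcoeff_ideal_mul => // v.
rewrite mcoeff_generic_comb; apply: (ideal_sum _ (idealgen_ideal _)) => i _.
by apply: (ideal_mull _ (idealgen_ideal _)); apply: sub_idealgen; exists i.
Qed.

(* Below [p], no multinomial coefficient vanishes; differentiating
   [G ^+ k.+1] recovers [k.+1%:R * g i * G ^+ k]. *)
Lemma ideal_pow_sub_content k : (k < p)%N -> ideal_pow a k `<=` content (G ^+ k).
Proof.
have iC F := idealgen_ideal [set (F : {mpoly R[m]})@_u | u in setT].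
elim: k => [|k IHk] kp.
  move=> x _; rewrite -[x]mulr1; apply: (ideal_mull _ (iC _)).
  by apply: sub_idealgen; exists 0%MM => //; rewrite mcoeff1 eqxx.
rewrite ideal_powS; apply: (ideal_mul_min (iC _)) => x y ax /(IHk (ltnW kp)).
move: x y ax; apply: (ideal_mul_gen (iC _)) => _ _ [i _ <-] [u _ <-].
have [c cE] : exists c : R, c * k.+1%:R = 1.
  have [c d cdE _] := egcdnP p (ltn0Sn k).
  have kp1 : coprime k.+1 p by rewrite coprime_sym prime_coprime // gtnNdvd.
  exists c%:R; rewrite -natrM cdE (eqP kp1) natrD natrM (pcharf0 charRp).
  by rewrite mulr0 add0r.
have -> : g i * (G ^+ k)@_u = c * (k.+1%:R * g i * (G ^+ k)@_u).
  by rewrite !mulrA cE mul1r.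
apply: (ideal_mull _ (iC _)).
have -> : k.+1%:R * g i * (G ^+ k)@_u = (u i).+1%:R * (G ^+ k.+1)@_(u + U_(i)).
  rewrite [RHS]mulr_natl -mcoeff_deriv.
  have -> : (G ^+ k.+1)^`M(i) = (k.+1%:R * g i)%:MP * G ^+ k.
    elim: (k) => [|l IHl]; first by rewrite expr1 expr0 mulr1 mul1r mderiv_generic_comb.
    rewrite [G ^+ l.+2]exprS mderivM IHl mderiv_generic_comb mulrCA -exprS -mulrDl.
    by rewrite -mpolyCD -[in RHS]natr1 mulrDl mul1r addrC.
  by rewrite mcoeffCM.
by apply: (ideal_mull _ (iC _)); exact: mcoeff_content.
Qed.

Lemma mcoeff_frob_pow k u : frob_pow p a k (G ^+ k)@_u.
Proof.
have k_lt : (k < p ^ (trunc_log p k).+1)%N by exact: trunc_log_ltn.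
have GE : G ^+ k = \prod_(i < (trunc_log p k).+1) (G ^+ digit p k i) ^+ (p ^ i).
  rewrite {1}(digit_sum p_gt1 k_lt) -prodrXr; apply: eq_bigr => i _.
  by rewrite exprM.
rewrite /frob_pow GE.
pose K (I : set R) (F : {mpoly R[m]}) := forall u, I F@_u.
move: u; rewrite -/(K _ _); apply: (big_rec2 K) => // i F I _ KF u.
apply: mcoeff_ideal_mul => // v {u}.
have [->|[t ->]] := mcoeff_expq charRp i (G ^+ digit p k i) v.
  exact: ideal0 (frob_pow_q_ideal _ _).
by apply: mem_frob_pow_q; exact: mcoeff_generic_comb_exp.
Qed.

(** The digitwise factorization behind Lucas's theorem. Induction strips the lowest digit, after
    which the Frobenius powers start one step higher; the offset [s] records this. *)
Lemma frob_prod_sub_content n s (d : nat -> nat) : (forall i, d i < p)%N ->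
  \big[@ideal_mul R/setT]_(i < n) frob_pow_q (p ^ (s + i)) (ideal_pow a (d i)) `<=`
  content ((\prod_(i < n) (G ^+ d i) ^+ (p ^ i)) ^+ (p ^ s)).
Proof.
elim: n s d => [|n IHn] s d dp.
  rewrite !big_ord0 expr1n => x _; rewrite -[x]mulr1; apply: (ideal_mull _ (idealgen_ideal _)).
  by apply: sub_idealgen; exists 0%MM => //; rewrite mcoeff1 eqxx.
rewrite !big_ord_recl /= addn0 expn0 expr1.
set H := \prod_(i < n) (G ^+ d i.+1) ^+ (p ^ i).
have -> : \prod_(i < n) (G ^+ d (bump 0 i)) ^+ (p ^ bump 0 i) = H ^+ (p ^ 1).
  by rewrite -prodrXl; apply: eq_bigr => i _; rewrite /bump add1n expn1 expnSr exprM.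
under eq_bigr => i _ do rewrite /bump add1n addnS -addSn.
have {IHn} IH := IHn s.+1 (fun i => d i.+1) (fun i => dp i.+1).
apply: (ideal_mul_min (idealgen_ideal _)) => x y Ix /IH.
have {Ix}: content ((G ^+ d 0) ^+ (p ^ s)) x.
  apply: (frob_pow_q_content charRp); move: x Ix.
  by apply: frob_pow_qS; exact: ideal_pow_sub_content.
rewrite !(content_expq charRp) -/H; move: x y.
apply: (ideal_mul_gen (idealgen_ideal _)) => _ _ [u _ <-] [v _ <-].
(* A nonzero coefficient puts [u] in the support, so its exponents are below [p] and the coefficient
   at [u + p v] is a single product. *)
have [->|u0] := eqVneq (G ^+ d 0)@_u 0.
  rewrite expr0n expn_eq0 eqn0Ngt p_gt0 mul0r.
  exact: ideal0 (idealgen_ideal _).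
have supp w : w \in msupp (G ^+ d 0) -> forall i, (w i < p ^ 1)%N.
  move=> /msupp_generic_comb_exp w_d i; rewrite expn1.
  by apply: leq_ltn_trans (dp 0); rewrite -w_d mnm_le_mdeg.
apply: sub_idealgen; exists ((u + v *+ (p ^ 1)) *+ (p ^ s))%MM => //.
rewrite (mcoeff_expq_muln charRp) (mcoeff_mul_expq charRp) //; last by apply: supp; rewrite mcoeff_msupp.
by rewrite exprMn -exprM -expnD add1n.
Qed.

(** It replaces digits by powers of one polynomial, which makes the comparison of [a^[k]] for
    different [k] immediate. *)
Lemma frob_powE k : frob_pow p a k = content (G ^+ k).
Proof.
apply/seteqP; split; last first.
  apply: content_min (mcoeff_frob_pow k).
  by rewrite /frob_pow big_ord_recl; exact: ideal_mul_ideal.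
have k_lt : (k < p ^ (trunc_log p k).+1)%N by exact: trunc_log_ltn.
rewrite {2}(digit_sum p_gt1 k_lt) -prodrXr.
have := @frob_prod_sub_content (trunc_log p k).+1 0 (digit p k).
rewrite expn0 expr1; under [in content _]eq_bigr => i _ do rewrite -exprM.
by apply => i; rewrite ltn_mod.
Qed.

End GenericCombination.

(** * Frobenius roots *)

Section FrobeniusRoots.
Variables (p m : nat) (R : idomainType) (charRp : p \in [pchar R]).
Hypotheses (R_Ffin : F_finite p R) (R_reg : regular_domain R).
Implicit Types (C : set {mpoly R[m]}) (I c : set R).

Let p_gt0 : (0 < p)%N. Proof. exact/prime_gt0/(pcharf_prime charRp). Qed.

(** In a term [d z^w F^q], only [w = u + q s] reaches the residue class of [u] modulo [q]; there it
    acts as [d (z^s F)^q], with [z^s F] still in [C]. *)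
Lemma mcoeff_frob_pow_q e C f (u : 'X_{1..m}) : is_ideal C ->
  frob_pow_q (p ^ e) C f -> (forall i, u i < p ^ e)%N ->
  exists n (b : 'I_n -> R) (E : 'I_n -> {mpoly R[m]}), (forall j, C (E j)) /\
    forall v, f@_(u + v *+ (p ^ e)) = \sum_(j < n) (E j)@_v ^+ (p ^ e) * b j.
Proof.
set q := (p ^ e)%N => iC + uq.
pose W f := exists n (b : 'I_n -> R) (E : 'I_n -> {mpoly R[m]}), (forall j, C (E j)) /\
  forall v, f@_(u + v *+ q) = \sum_(j < n) (E j)@_v ^+ q * b j.
have W0 : W 0.
  by exists 0%N, (fun=> 0), (fun=> 0); split=> [[]//|v]; rewrite big_ord0 mcoeff0.
have WD f1 f2 : W f1 -> W f2 -> W (f1 + f2).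
  move=> [n [b [E [CE fE]]]] [n' [b' [E' [CE' fE']]]].
  exists (n + n')%N, (fun i => match split i with inl k => b k | inr k => b' k end).
  exists (fun i => match split i with inl k => E k | inr k => E' k end).
  split=> [i|v]; first by case: (split i).
  rewrite mcoeffD fE fE' big_split_ord /=; congr (_ + _); apply: eq_bigr => i _.
    by rewrite (unsplitK (inl i)).
  by rewrite (unsplitK (inr i)).
have WX d w F : C F -> W (d *: 'X_[w] * F ^+ q).
  move=> CF; have [[s wE]|nw] := pselect (exists s, w = (u + s *+ q)%MM); last first.
    exists 0%N, (fun=> 0), (fun=> 0); split=> [[]//|v].
    rewrite big_ord0 (mcoeff_monomial_mul_expq charRp) big1 ?mulr0 // => t _.
    have [/mnmP wt|_] := eqP; last by rewrite mulr0.
    (* The subtraction does not truncate: [t i > v i] would make [w i + t i * q] at least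
       [(v i + 1) * q], above [u i + v i * q]. *)
    case: nw; exists (v - t)%MM; apply/mnmP => i.
    have := wt i; rewrite !mnmDE !mulmnE mnmBE => wti.
    have := uq i; rewrite -/q mulnBl; case: (leqP (t i) (v i)) => [tv|vt].
      by have := leq_mul tv (leqnn q); lia.
    by have := leq_mul vt (leqnn q); rewrite mulSn; lia.
  exists 1%N, (fun=> d), (fun=> 'X_[s] * F); split=> [_|v]; first exact: ideal_mull.
  rewrite big_ord1 (mcoeff_monomial_mul_expq charRp) mulrC; congr (_ * _).
  have -> : ('X_[s] * F)@_v = \sum_(t <- msupp F) F@_t * (s + t == v)%MM%:R.
    have := mcoeff_monomial_mul_expq charRp 0 1 s F v.
    rewrite scale1r expr1 mul1r => ->.
    by apply: eq_bigr => t _; rewrite expn0 expr1 mulm1n.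
  rewrite /q (sum_expq _ _ _ _ charRp); apply: eq_bigr => t _; rewrite exprMn; congr (_ * _).
  rewrite wE -addmA eqm_add2l.
  have -> : (s *+ p ^ e + t *+ p ^ e = (s + t) *+ p ^ e)%MM.
    by apply/mnmP => i; rewrite mnmDE !mulmnE mnmDE mulnDl.
  rewrite (mnm_muln_inj charRp); case: (_ == _); rewrite ?expr1n //.
  by rewrite (expq0 charRp).
move=> /idealgen_sum[n [h [F' [FP ->]]]].
apply: (big_ind W) => // j _; have [F CF <-] := FP j.
rewrite (mpolyE (h j)) mulr_suml; apply: (big_ind W) => // w _; exact: WX.
Qed.

(* Comparing coefficients of [f] in the residue class of [u] modulo [p ^ e] gives
   [f@_u = \sum_j b j * F_j], where [F_j] is [E j] with all coefficients raised to
   the power [p ^ e]: a linear system over the subring of [p ^ e]-th powers, which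
   flatness solves inside [R]. *)
Lemma contraction_frob_pow_q e C f (u : 'X_{1..m}) : is_ideal C ->
  frob_pow_q (p ^ e) C f -> (forall i, u i < p ^ e)%N ->
  (forall v, v != 0%MM -> f@_(u + v *+ (p ^ e)) = 0) ->
  frob_pow_q (p ^ e) [set c | C c%:MP] f@_u.
Proof.
move=> iC Cf uq fv0; have [n [b [E [CE fE]]]] := mcoeff_frob_pow_q iC Cf uq.
set q := (p ^ e)%N in fv0 fE *.
(* One equation per monomial of the [E j]; [0] is added because its equation carries [f@_u]. *)
pose ms := 0%MM :: flatten [seq msupp (E j) | j <- enum 'I_n].
pose mon (i : 'I_(size ms)) := nth 0%MM ms i.
pose A : 'M[R]_(size ms, 1 + n) :=
  row_mx (\col_i (mon i == 0%MM)%:R) (\matrix_(i, j) (E j)@_(mon i)).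
pose y : 'cV[R]_(1 + n) := col_mx (- f@_u)%:M (\col_j b j).
have [|k [Y [B [AY yE]]]] := @frobenius_flat p R charRp R_Ffin R_reg e _ _ _ A y.
  apply/matrixP => i j; rewrite ord1 mxE [RHS]mxE big_split_ord big_ord1 /=.
  rewrite [X in X * _]mxE row_mxEl col_mxEu !mxE eqxx mulr1n.
  have -> : \sum_(l < n) mxfrob q A i (rshift 1 l) * y (rshift 1 l) 0 =
      f@_(u + mon i *+ q).
    by rewrite fE; apply: eq_bigr => l _; rewrite [X in X * _]mxE row_mxEr col_mxEd !mxE.
  have [->|mi0] := eqVneq (mon i) 0%MM; last by rewrite (expq0 charRp) mul0r add0r fv0.
  rewrite expr1n mul1r; suff -> : (u + 0 *+ q)%MM = u by rewrite addNr.
  by apply/mnmP => l; rewrite mnmDE mulmnE mnm0E mul0n addn0.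
(* Read over all monomials, a solution column says that its first entry, as a constant polynomial,
   is a combination of the [E j]. *)
have CY l : C (Y (lshift n 0) l)%:MP.
  have -> : (Y (lshift n 0) l)%:MP = - \sum_(j < n) (Y (rshift 1 j) l)%:MP * E j.
    apply/mpolyP => v; rewrite mcoeffC mcoeffN raddf_sum /=.
    under eq_bigr => j _ do rewrite mcoeffCM.
    have [vms|vms] := boolP (v \in ms).
      have vlt : (index v ms < size ms)%N by rewrite index_mem.
      have vE : mon (Ordinal vlt) = v by rewrite /mon /= nth_index.
      have /matrixP/(_ (Ordinal vlt) l) := AY.
      rewrite !mxE big_split_ord big_ord1 /= row_mxEl mxE vE => /eqP.
      rewrite addr_eq0 => /eqP e1; rewrite mulrC e1; congr (- _).
      by apply: eq_bigr => j _; rewrite row_mxEr mxE vE mulrC.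
    rewrite big1 => [|j _].
      case: eqP vms => [->|_ _]; first by rewrite in_cons eqxx.
      by rewrite mulr0 oppr0.
    suff /memN_msupp_eq0-> : v \notin msupp (E j) by rewrite mulr0.
    apply: contra vms => vE; rewrite in_cons; apply/orP; right.
    by apply/flatten_mapP; exists j; rewrite ?mem_enum.
  apply: idealN => //; apply: ideal_sum => // j _; exact: ideal_mull.
have iq := frob_pow_q_ideal q [set c | C c%:MP].
have /matrixP/(_ (lshift n 0) 0) := yE.
rewrite col_mxEu !mxE eqxx mulr1n => e1; rewrite -[f@_u]opprK e1.
apply: (idealN iq); apply: (ideal_sum _ iq) => l _; apply: (ideal_mulr _ iq).
by rewrite mxE; apply: mem_frob_pow_q; exact: CY.
Qed.

Lemma frob_root_ideal (S : comNzRingType) e (I : set S) : is_ideal (frob_root p e I).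
Proof.
split=> [c [ic _]|x y Ix Iy c Ic|b x Ix c Ic]; first exact: ideal0.
- by apply: idealD; [case: Ic | exact: Ix | exact: Iy].
- by apply: ideal_mull; [case: Ic | exact: Ix].
Qed.

Variable (g : 'I_m -> R).
Local Notation G := (generic_comb g).
Local Notation a := (idealgen (range g)).

(** The ideals tested by the two roots correspond: an admissible [c] in [R] extends to an admissible
    ideal, and an admissible [C] contracts to one. *)
Lemma frob_root_generic_comb e k : (k < p ^ e)%N ->
  frob_root p e (idealgen [set G ^+ k]) = mext (m := m) (frob_pow_frac p a k e).
Proof.
move=> kq; apply/seteqP; split=> f.
  move=> rf; apply/mextP; first exact: frob_root_ideal.
  move=> u c [ic ac].
  have /(mextP _ ic) : mext (m := m) c f; last by apply.
  apply: rf; split; first exact: mext_ideal.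
  apply: idealgen_min => [|_ ->]; first exact: frob_pow_q_ideal.
  have : mext (m := m) (frob_pow_q (p ^ e) c) (G ^+ k).
    apply/mextP => [|v]; first exact: frob_pow_q_ideal.
    by apply: ac; exact: mcoeff_frob_pow.
  move: (_ ^+ k); apply: idealgen_min => [|_ [d dc <-]]; first exact: frob_pow_q_ideal.
  move: d dc; apply: (frob_pow_q_min (mpolyC_preimage_ideal (frob_pow_q_ideal _ _))).
  move=> d cd /=; rewrite rmorphXn; apply: mem_frob_pow_q.
  exact: mem_mext.
move=> rf C [iC GC].
have ic := mpolyC_preimage_ideal iC.
move: f rf; apply: idealgen_min => // _ [d rd <-].
apply: (rd [set c | C c%:MP]); split=> //.
rewrite (frob_powE charRp); apply: content_min => [|u]; first exact: frob_pow_q_ideal.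
have [->|uG] := eqVneq (G ^+ k)@_u 0; first exact: ideal0 (frob_pow_q_ideal _ _).
have uk : mdeg u = k by apply: (msupp_generic_comb_exp (g := g)); rewrite mcoeff_msupp.
apply: contraction_frob_pow_q => //.
- by apply: GC; exact: sub_idealgen.
- by move=> i; apply: leq_ltn_trans kq; rewrite -uk mnm_le_mdeg.
(* Homogeneity: [u] already has the full degree [k], so a nonzero shift leaves the support. *)
move=> v v0; apply/eqP; rewrite mcoeff_eq0; apply/negP => /msupp_generic_comb_exp.
rewrite mdegD uk mdegMn => /eqP.
rewrite -[X in _ == X]addn0 eqn_add2l muln_eq0 mdeg_eq0 (negPf v0) /=.
by rewrite expn_eq0 eqn0Ngt p_gt0.
Qed.

Lemma frob_pow_anti k l : (k <= l)%N -> frob_pow p a l `<=` frob_pow p a k.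
Proof. by move=> kl; rewrite !(frob_powE charRp) -(subnKC kl) exprD; exact: content_mulr. Qed.

(** For [y] in [a^[k]], [y^p] is in [a^[pk]], hence in [a^[l]] and in the [p]-th Frobenius power of
    [c^[p^e]]; faithfulness removes the exponent [p]. *)
Lemma frob_pow_frac_asc e k l : (l <= p * k)%N ->
  frob_pow_frac p a k e `<=` frob_pow_frac p a l e.+1.
Proof.
move=> lpk x rx c [ic lc]; apply: rx; split=> // y ay.
apply: (frob_pow_q_faithful charRp R_Ffin R_reg (e := 1)) (frob_pow_q_ideal _ _) _.
have : frob_pow p a l (y ^+ (p ^ 1)).
  apply: (frob_pow_anti lpk); rewrite (frob_powE charRp) -[X in (X * k)%N]expn1 mulnC exprM.
  apply: (frob_pow_q_content charRp); apply: mem_frob_pow_q.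
  by rewrite -(frob_powE charRp).
move/lc; move: (y ^+ _); apply: frob_pow_q_min => [|d cd]; first exact: frob_pow_q_ideal.
by rewrite [(p ^ e.+1)%N]expnSr exprM expn1; do 2 apply: mem_frob_pow_q.
Qed.

(** With [q = p ^ e], [g i ^+ q] is the coefficient of [z_i^q] in [G ^+ q], hence in [a^[q]];
    faithfulness then extracts [g i]. *)
Lemma sub_frob_pow_frac e k : (k <= p ^ e)%N -> a `<=` frob_pow_frac p a k e.
Proof.
move=> kq; apply: idealgen_min => [|_ [i _ <-]]; first exact: frob_root_ideal.
move=> c [ic kc]; apply: (frob_pow_q_faithful charRp R_Ffin R_reg (e := e)) => //.
apply: kc; apply: (frob_pow_anti kq); rewrite (frob_powE charRp).
rewrite -(mcoeff_generic_combU g i) -(mcoeff_expq_muln charRp).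
exact: mcoeff_content.
Qed.

(** * Real exponents *)

Section RealExponent.
Variables (K : realType) (t : K).
Hypotheses (t_gt0 : 0 < t) (t_lt1 : t < 1).
Local Notation N e := (ceil_pexp p t e).
Local Notation I_ e := (frob_pow_frac p a (N e) e).

Lemma ceil_pexp_leP e k : (N e <= k)%N = (t * p%:R ^+ e <= k%:R).
Proof.
have tp0 : 0 < t * p%:R ^+ e by rewrite mulr_gt0 // exprn_gt0 // ltr0n.
have c0 : 0 <= Num.ceil (t * p%:R ^+ e) by rewrite ceil_ge0 (lt_trans _ tp0) ?ltrN10.
rewrite -lez_nat /ceil_pexp gez0_abs // ceil_le_int //.
Qed.

Lemma ceil_pexp_le e : (N e <= p ^ e)%N.
Proof.
by rewrite ceil_pexp_leP natrX ger_pMl ?(ltW t_lt1) // exprn_gt0 // ltr0n.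
Qed.

Lemma ceil_pexpS e : (N e.+1 <= p * N e)%N.
Proof.
rewrite ceil_pexp_leP natrM exprS mulrCA ler_pM2l ?ltr0n //.
by rewrite -ceil_pexp_leP.
Qed.

Lemma ceil_pexp_lt : exists e0, forall e, (e0 <= e)%N -> (N e < p ^ e)%N.
Proof.
have p_gt1 : (1 < p)%N by exact/prime_gt1/(pcharf_prime charRp).
have t1 : 0 < 1 - t by rewrite subr_gt0.
(* For [q = p ^ e], [t q <= q - 1] amounts to [q >= (1 - t)^-1], and [p ^ e > e]. *)
pose e0 := Num.bound (1 - t)^-1.
exists e0 => e e0e; have q_gt0 : (0 < p ^ e)%N by rewrite expn_gt0 p_gt0.
rewrite -(prednK q_gt0) ltnS ceil_pexp_leP -subn1 natrB // natrX.
have : (1 - t)^-1 < (p ^ e)%:R.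
  apply: (lt_le_trans (archi_boundP _)); first by rewrite invr_ge0 ltW.
  by rewrite ler_nat; apply: (leq_trans e0e); exact/ltnW/ltn_expl.
rewrite -(ltr_pM2l t1) divff ?gt_eqF // natrX => lt1.
by lra.
Qed.

Lemma frob_pow_frac_real_le e e' : (e <= e')%N -> I_ e `<=` I_ e'.
Proof.
elim: e' => [|e' IHe]; first by rewrite leqn0 => /eqP->.
rewrite leq_eqVlt => /predU1P[-> //|/IHe II x /II].
by apply: frob_pow_frac_asc; exact: ceil_pexpS.
Qed.

Lemma frob_pow_real_ideal : is_ideal (frob_pow_real p a t).
Proof.
split=> [|x y [e _ Ix] [e' _ Iy]|b x [e _ Ix]].
- by exists 0%N => //; exact: ideal0 (frob_root_ideal _ _).
- exists (maxn e e') => //; apply: (idealD (frob_root_ideal _ _)).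
    exact: frob_pow_frac_real_le (leq_maxl _ _) _ Ix.
  exact: frob_pow_frac_real_le (leq_maxr _ _) _ Iy.
- by exists e => //; apply: (ideal_mull _ (frob_root_ideal _ _)).
Qed.

Lemma test_ideal_generic_comb :
  test_ideal p (idealgen [set G]) t = mext (m := m) (frob_pow_real p a t).
Proof.
have [e0 e0P] := ceil_pexp_lt.
have mextS (I J : set R) : I `<=` J -> mext (m := m) I `<=` mext J.
  by move=> IJ; apply: idealgenS => _ [c Ic <-]; exists c => //; exact: IJ.
have I_sub e : I_ e `<=` frob_pow_real p a t by move=> x Ix; exists e.
apply/seteqP; split=> f.
  move=> [e _]; rewrite ideal_pow_principal => rf.
  have [lt_e|ge_e] := ltnP (N e) (p ^ e).
    by move: f rf; rewrite frob_root_generic_comb //; exact: mextS.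
  have Ne : N e = (p ^ e)%N by apply/eqP; rewrite eqn_leq ceil_pexp_le.
  apply: (mextS (I_ e0)) => //; apply: (mextS a).
    by apply: sub_frob_pow_frac; exact: ceil_pexp_le.
  have : idealgen [set G] f.
    apply: rf; split; first exact: idealgen_ideal.
    apply: idealgen_min => [|_ ->]; first exact: frob_pow_q_ideal.
    by rewrite Ne; apply: mem_frob_pow_q; exact: sub_idealgen.
  move: f {rf}; apply: idealgen_min => [|_ ->]; first exact: mext_ideal.
  apply/mextP => [|u]; first exact: idealgen_ideal.
  have := mcoeff_generic_comb_exp g 1 u; rewrite expr1 ideal_powS.
  move: (G@_u); apply: ideal_mul_min => [|x y ax _]; first exact: idealgen_ideal.
  exact: (ideal_mulr _ (idealgen_ideal _)).
move/(mextP _ frob_pow_real_ideal) => fI.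
have [h hP] := choice (fun u => let: ex_intro2 e _ Ie := fI u in ex_intro (fun e => I_ e f@_u) e Ie).
(* A single level contains the finitely many coefficients of [f]; adding [e0] ensures
   [N e < p ^ e]. *)
pose e := (\max_(u <- msupp f) h u + e0)%N.
exists e => //; rewrite ideal_pow_principal frob_root_generic_comb; last first.
  by apply: e0P; exact: leq_addl.
apply/mextP => [|u]; first exact: frob_root_ideal.
have [fu|/memN_msupp_eq0 ->] := boolP (u \in msupp f); last first.
  exact: ideal0 (frob_root_ideal _ _).
apply: frob_pow_frac_real_le (hP u); apply: leq_trans (leq_addr _ _).
by rewrite (leq_bigmax_seq u).
Qed.

End RealExponent.
End FrobeniusRoots.

Theorem theorem5p3 (p : nat) (R : idomainType) (charRp : p \in [pchar R])
    (R_Ffin : F_finite p R) (R_reg : regular_domain R)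
    (m : nat) (g : 'I_m -> R) (K : realType) (t : K) (t_gt0 : 0 < t) (t_lt1 : t < 1) :
  let a := idealgen (range g) in
  let tauG := test_ideal p (idealgen [set generic_comb g]) t in
  let iota := fun c : R => c%:MP_[m] in
  tauG = idealgen (iota @` frob_pow_real p a t) /\
  frob_pow_real p a t = iota @^-1` tauG.
Proof.
move=> a tauG iota.
have tauE : tauG = mext (frob_pow_real p a t) by exact: test_ideal_generic_comb.
split=> //; rewrite tauE; apply/seteqP; split=> c /=; first exact: mem_mext.
(* The constant coefficient recovers an ideal from its extension. *)
move=> /mextP; rewrite /iota => /(_ _ 0%MM); rewrite mcoeffC eqxx mulr1; apply.
exact: frob_pow_real_ideal.
Qed.
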